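(* Let $a<b$, $n\in\mathbb N$, and $\alpha=(\alpha_1,\ldots,\alpha_n)$ with $\alpha_i\in(i-1,i)$. Fix reals $z_a$ and $x^j_{ia}$ for $i\in\{1,\ldots,n\}$, $j\in\{0,\ldots,i-1\}$. Call $x=(x_1,\ldots,x_n)$ admissible if $x_i\in C^n([a,b],\mathbb R)$, ${^C_aD^{\alpha_i}_t}x_i\in C^1([a,b],\mathbb R)$ and $x_i^{(j)}(a)=x^j_{ia}$ for all $i$ and $j\in\{0,\ldots,i-1\}$ (the values $x_i^{(j)}(b)$ are free). Let $L:[a,b]\times\mathbb R^{2n+1}\to\mathbb R$, $L=L(t,x,v,z)$, be of class $C^1$, and for admissible $x$ let $z[x;\cdot]$ solve $\dot z(t)=L(t,x(t),{^C_aD^\alpha_t}x(t),z(t))$, $t\in[a,b]$, $z(a)=z_a$, where ${^C_aD^\alpha_t}x=({^C_aD^{\alpha_1}_t}x_1,\ldots,{^C_aD^{\alpha_n}_t}x_n)$. Write $[x,z](t):=(t,x(t),{^C_aD^\alpha_t}x(t),z(t))$, $\lambda(t):=\exp\left(-\int_a^t\frac{\partial L}{\partial z}[x,z](\tau)\,d\tau\right)$, and assume ${_tD^{\alpha_i}_b}\left(\lambda(t)\frac{\partial L}{\partial {^C_aD^{\alpha_i}_t}x_i}[x,z](t)\right)$ exists and is continuous on $[a,b]$ for each $i$. If $x$ is admissible and $z[x;b]$ attains an extremum (so $\frac{d}{d\epsilon}z[x+\epsilon\eta;b]|_{\epsilon=0}=0$ for all $\eta$ of the same regularity with $\eta_i^{(j)}(a)=0$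 for all $i$, $j\in\{0,\ldots,i-1\}$), then $(x_1,\ldots,x_n,z)$ satisfies on $[a,b]$ $$\lambda(t)\frac{\partial L}{\partial x_i}[x,z](t)+{_tD^{\alpha_i}_b}\left(\lambda(t)\frac{\partial L}{\partial {^C_aD^{\alpha_i}_t}x_i}[x,z](t)\right)=0,\quad i=1,\ldots,n,$$ and the transversality conditions $${_tD^{\alpha_i+j-i}_b}\left(\lambda(t)\frac{\partial L}{\partial {^C_aD^{\alpha_i}_t}x_i}[x,z](t)\right)\Big|_{t=b}=0$$ for all $i\in\{1,\ldots,n\}$ and all $j\in\{0,\ldots,i-1\}$.
   Context: For $\alpha>0$, $m=[\alpha]+1$ and $f:[a,b]\to\mathbb R$: left Caputo derivative ${^C_aD^\alpha_t}f(t)=\frac{1}{\Gamma(m-\alpha)}\int_a^t(t-\tau)^{m-\alpha-1}f^{(m)}(\tau)\,d\tau$; right Riemann–Liouville derivative ${_tD^\alpha_b}f(t)=\frac{(-1)^m}{\Gamma(m-\alpha)}\frac{d^m}{dt^m}\int_t^b(\tau-t)^{m-\alpha-1}f(\tau)\,d\tau$. For a negative order $-\beta<0$, ${_tD^{-\beta}_b}$ denotes the right Riemann–Liouville integral ${_tI^{\beta}_b}f(t)=\frac{1}{\Gamma(\beta)}\int_t^b(\tau-t)^{\beta-1}f(\tau)\,d\tau$. Partial derivatives of $L$ are with respect to the corresponding components of its arguments $(t,x,v,z)$; $\frac{\partial L}{\partial {^C_aD^{\alpha_i}_t}x_i}$ means $\partial L/\partial v_i$. The solution $z$ is assumed to exist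 and depend differentiably on a parameter $\epsilon$ when $x$ is replaced by $x+\epsilon\eta$, with the same initial value $z_a$. *)

(* Defs.v *)
From Stdlib Require Import Reals Lra Lia ZArith.
From Coquelicot Require Import Coquelicot.
Open Scope R_scope.

(** Index set {0,...,n-1}; paper index i (1-based) is val k + 1. *)
Definition idx (n : nat) := {i : nat | (i < n)%nat}.
Definition ival {n} (k : idx n) : nat := proj1_sig k.

Definition inI (a b t : R) : Prop := a <= t <= b.

Definition is_deriv_in (a b : R) (f : R -> R) (t l : R) : Prop :=
  filterlim (fun s => (f s - f t) / (s - t))
    (within (fun s => a <= s <= b /\ s <> t) (locally t)) (locally l).

(** The value of that derivative (meaningful when it exists). *)
Definition deriv_in (a b : R) (f : R -> R) (t : R) : R :=
  lim (filtermap (fun s => (f s - f t) / (s - t))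
         (within (fun s => a <= s <= b /\ s <> t) (locally t))).

Fixpoint dern (a b : R) (k : nat) (f : R -> R) : R -> R :=
  match k with
  | O => f
  | S k' => deriv_in a b (dern a b k' f)
  end.

Definition cont_on (a b : R) (f : R -> R) : Prop :=
  forall t, a <= t <= b ->
    filterlim f (within (fun s => a <= s <= b) (locally t)) (locally (f t)).

Definition Ck_on (k : nat) (a b : R) (f : R -> R) : Prop :=
  (forall j, (j < k)%nat -> forall t, a <= t <= b ->
      is_deriv_in a b (dern a b j f) t (dern a b (S j) f t)) /\
  (forall j, (j <= k)%nat -> cont_on a b (dern a b j f)).

Definition Gamma (s : R) : R :=
  RInt_gen (fun u => Rpower u (s - 1) * exp (- u)) (at_right 0) (Rbar_locally p_infty).

(** m = [alpha] + 1  (up x is the unique integer in (x, x+1]). *)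
Definition mord (alpha : R) : nat := Z.to_nat (up alpha).

(** Left Caputo derivative on [a,b]:
    1/Gamma(m-alpha) * int_a^t (t-tau)^(m-alpha-1) f^(m)(tau) dtau
    (improper integral over (a,t); the integral over [a,a] is 0). *)
Definition caputoL (a b alpha : R) (f : R -> R) (t : R) : R :=
  let m := mord alpha in
  if Rle_dec t a then 0 else
  / Gamma (INR m - alpha) *
  RInt_gen (fun tau => Rpower (t - tau) (INR m - alpha - 1) * dern a b m f tau)
           (at_right a) (at_left t).

(** Right Riemann-Liouville integral of order beta > 0 on [.,b]
    (improper integral over (t,b); the integral over [b,b] is 0). *)
Definition rl_int_right (b beta : R) (g : R -> R) (t : R) : R :=
  if Rle_dec b t then 0 else
  / Gamma beta *
  RInt_gen (fun tau => Rpower (tau - t) (beta - 1) * g tau) (at_right t) (at_left b).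

Definition rl_right (a b alpha : R) (g : R -> R) (t : R) : R :=
  let m := mord alpha in
  (-1) ^ m * dern a b m (rl_int_right b (INR m - alpha) g) t.

Definition rl_right_op (a b beta : R) (g : R -> R) (t : R) : R :=
  if Rlt_dec beta 0 then rl_int_right b (- beta) g t else rl_right a b beta g t.

Definition rl_right_exists_cont (a b alpha : R) (g : R -> R) : Prop :=
  let m := mord alpha in
  (forall j, (j < m)%nat -> forall t, a <= t <= b ->
     is_deriv_in a b (dern a b j (rl_int_right b (INR m - alpha) g)) t
                 (dern a b (S j) (rl_int_right b (INR m - alpha) g) t)) /\
  cont_on a b (rl_right a b alpha g).

Definition Lag (n : nat) := R -> (idx n -> R) -> (idx n -> R) -> R -> R.

Definition upd {n} (x : idx n -> R) (i : idx n) (y : R) : idx n -> R :=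
  fun k => if Nat.eqb (ival k) (ival i) then y else x k.

Definition dLx {n} (L : Lag n) (i : idx n) t x v z : R :=
  Derive (fun y => L t (upd x i y) v z) (x i).
Definition dLv {n} (L : Lag n) (i : idx n) t x v z : R :=
  Derive (fun y => L t x (upd v i y) z) (v i).
Definition dLz {n} (L : Lag n) t x v z : R :=
  Derive (fun y => L t x v y) z.
Definition dLt {n} (a b : R) (L : Lag n) t x v z : R :=
  deriv_in a b (fun s => L s x v z) t.

Definition cont_dom {n} (a b : R) (F : Lag n) : Prop :=
  forall t x v z, a <= t <= b -> forall eps, 0 < eps ->
  exists delta, 0 < delta /\
    forall t' x' v' z', a <= t' <= b -> Rabs (t' - t) < delta ->
      (forall k, Rabs (x' k - x k) < delta) ->
      (forall k, Rabs (v' k - v k) < delta) -> Rabs (z' - z) < delta ->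
      Rabs (F t' x' v' z' - F t x v z) < eps.

Definition C1_Lag {n} (a b : R) (L : Lag n) : Prop :=
  (forall t x v z, a <= t <= b ->
     is_deriv_in a b (fun s => L s x v z) t (dLt a b L t x v z) /\
     (forall i, ex_derive (fun y => L t (upd x i y) v z) (x i)) /\
     (forall i, ex_derive (fun y => L t x (upd v i y) z) (v i)) /\
     ex_derive (fun y => L t x v y) z) /\
  cont_dom a b L /\ cont_dom a b (dLt a b L) /\
  (forall i, cont_dom a b (dLx L i)) /\ (forall i, cont_dom a b (dLv L i)) /\
  cont_dom a b (dLz L).

Definition caputoV {n} (a b : R) (alpha : idx n -> R) (x : idx n -> R -> R) (t : R)
  : idx n -> R := fun i => caputoL a b (alpha i) (x i) t.

Definition regular {n} (a b : R) (alpha : idx n -> R) (x : idx n -> R -> R) : Prop :=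
  forall i, Ck_on n a b (x i) /\ Ck_on 1 a b (caputoL a b (alpha i) (x i)).

(** Admissible trajectories: x_i^(j)(a) = xa i j for j in {0,...,i-1} (1-based i). *)
Definition admissible {n} (a b : R) (alpha : idx n -> R) (xa : idx n -> nat -> R)
  (x : idx n -> R -> R) : Prop :=
  regular a b alpha x /\
  forall i j, (j <= ival i)%nat -> dern a b j (x i) a = xa i j.

Definition variation {n} (a b : R) (alpha : idx n -> R) (eta : idx n -> R -> R) : Prop :=
  regular a b alpha eta /\
  forall i j, (j <= ival i)%nat -> dern a b j (eta i) a = 0.

Definition solves_ivp {n} (a b : R) (alpha : idx n -> R) (L : Lag n) (za : R)
  (x : idx n -> R -> R) (z : R -> R) : Prop :=
  z a = za /\
  forall t, a <= t <= b ->
    is_deriv_in a b z t (L t (fun i => x i t) (caputoV a b alpha x t) (z t)).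

Definition perturb {n} (x eta : idx n -> R -> R) (e : R) : idx n -> R -> R :=
  fun i t => x i t + e * eta i t.

Definition lam {n} (a b : R) (alpha : idx n -> R) (L : Lag n)
  (x : idx n -> R -> R) (z : R -> R) (t : R) : R :=
  exp (- RInt (fun tau => dLz L tau (fun i => x i tau) (caputoV a b alpha x tau) (z tau)) a t).

Definition lamLv {n} (a b : R) (alpha : idx n -> R) (L : Lag n)
  (x : idx n -> R -> R) (z : R -> R) (i : idx n) (t : R) : R :=
  lam a b alpha L x z t * dLv L i t (fun k => x k t) (caputoV a b alpha x t) (z t).

(* Main.v *)
Require Import Defs.
From Stdlib Require Import Reals Lra Lia ZArith.
From Stdlib Require Import FunctionalExtensionality Classical ClassicalEpsilon.
From Coquelicot Require Import Coquelicot.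
Open Scope R_scope.

(** Vary one component only, by an [(n+1)]-fold iterated integral [h] from [a] of a
    continuous [u] that vanishes on [(-oo, a]]. A continuity argument for the state
    equation makes the difference of the states [O(e)] uniformly in [t], so stationarity
    of [z(b)] becomes [int_a^b lambda (L_x h + L_v D^alpha h) = 0]. Put [g = lambda L_v],
    [m = [alpha] + 1] and let [G] be the right fractional integral of [g] of order
    [m - alpha]. Fractional integration by parts turns the second term into
    [int_a^b h^(m) G], and [m] ordinary ones turn the first into [int_a^b h^(m) P], where
    [P] is the [m]-fold iterated integral of [lambda L_x] towards [b]. As [u] is arbitrary,
    [G = - P] on [[a, b]]. Differentiating [m] times gives the Euler-Lagrange equation, and
    the derivatives of [P] of order below [m] vanish at [b], which is transversality.

    The singular kernel is removed by the substitution [s = (t - tau)^(m - alpha)], and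
    functions on [[a, b]] are extended to the line by clamping the argument, so that only
    continuous functions on the whole line are integrated. *)

(** * Continuous functions on the line *)

(** Freedom at [b] is what makes [G = - P] exact: [u] is unrestricted near [b], whereas derivatives
    also fixed at [b] would leave a polynomial of degree below [m] undetermined. So the
    Euler-Lagrange equation and all transversality conditions are read off one identity, and no
    boundary term is ever collected.

    The depth [n + 1] comes from regularity. The Caputo derivative uses up [m <= n] of the
    integrations, so at least one is left, and [D^alpha h] is a kernel integral of a [C^1] function,
    hence itself [C^1].

    Differentiability in [e] at each [t] separately does not allow [d/dt] and [d/de] to be exchanged
    in the state equation. The linearization is therefore an estimate on the difference of two
    states, in which the remainder is controlled only while that difference is small.

    The factor [/ Gamma beta] stands in front of both fractional operators and is carried along as
    an opaque constant. *)

Definition ctn (f : R -> R) : Prop := forall t, continuous f t.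

Lemma ctn_ext (f g : R -> R) : (forall t, f t = g t) -> ctn f -> ctn g.
Proof. intros H Hf t. now apply continuous_ext with f. Qed.

Lemma ctn_comp (f g : R -> R) : ctn f -> ctn g -> ctn (fun t => g (f t)).
Proof. intros Hf Hg t. apply continuous_comp; auto. Qed.

Lemma ctn_const (c : R) : ctn (fun _ => c).
Proof. intro t. apply continuous_const. Qed.

Lemma ctn_id : ctn (fun t => t).
Proof. intro t. apply continuous_id. Qed.

Lemma ctn_plus (f g : R -> R) : ctn f -> ctn g -> ctn (fun t => f t + g t).
Proof. intros Hf Hg t. apply (continuous_plus f g); auto. Qed.

Lemma ctn_mult (f g : R -> R) : ctn f -> ctn g -> ctn (fun t => f t * g t).
Proof. intros Hf Hg t. apply (continuous_mult f g); auto. Qed.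

Lemma ctn_opp (f : R -> R) : ctn f -> ctn (fun t => - f t).
Proof. intros Hf t. apply (continuous_opp f); auto. Qed.

Lemma ctn_minus (f g : R -> R) : ctn f -> ctn g -> ctn (fun t => f t - g t).
Proof. intros Hf Hg t. apply (continuous_minus f g); auto. Qed.

Lemma ctn_exp (f : R -> R) : ctn f -> ctn (fun t => exp (f t)).
Proof. intros Hf. apply (ctn_comp f exp Hf). intro t. apply continuous_exp. Qed.

Lemma ctn_pt (f : R -> R) : ctn f -> forall t, continuity_pt f t.
Proof. intros Hf t. apply continuity_pt_filterlim, Hf. Qed.

Lemma ctn_is_derive (f df : R -> R) : (forall t, is_derive f t (df t)) -> ctn f.
Proof. intros H t. apply (ex_derive_continuous f). now exists (df t). Qed.

#[local] Hint Resolve ctn_const ctn_id ctn_plus ctn_mult ctn_opp ctn_minus ctn_exp : ctn.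

Lemma ctn_eps (f : R -> R) :
  (forall t eps, 0 < eps -> exists delta, 0 < delta /\
     forall s, Rabs (s - t) < delta -> Rabs (f s - f t) < eps) -> ctn f.
Proof.
  intros H t. apply filterlim_locally. intros eps.
  destruct (H t eps (cond_pos eps)) as [d [Hd Hs]].
  exists (mkposreal d Hd). intros s Hst. apply Hs, Hst.
Qed.

Lemma ctn_eps_inv (f : R -> R) : ctn f ->
  forall t eps, 0 < eps -> exists delta, 0 < delta /\
     forall s, Rabs (s - t) < delta -> Rabs (f s - f t) < eps.
Proof.
  intros H t eps He.
  destruct (proj1 (filterlim_locally _ _) (H t) (mkposreal eps He)) as [d Hd].
  exists d. split; [apply cond_pos|]. intros s Hs. apply (Hd s Hs).
Qed.

Lemma ctn_ex_RInt (f : R -> R) (a b : R) : ctn f -> ex_RInt f a b.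
Proof. intros H. apply (ex_RInt_continuous f). intros; apply H. Qed.

#[local] Hint Resolve ctn_ex_RInt : ctn.

Lemma ctn_is_derive_RInt (f : R -> R) (a t : R) :
  ctn f -> is_derive (fun t => RInt f a t) t (f t).
Proof.
  intros H. apply (is_derive_RInt f (fun t => RInt f a t) a t); [|apply H].
  apply filter_forall. intro s. apply (RInt_correct f), ctn_ex_RInt, H.
Qed.

Lemma ctn_is_derive_RInt_l (f : R -> R) (b t : R) :
  ctn f -> is_derive (fun t => RInt f t b) t (- f t).
Proof.
  intros H. apply (is_derive_RInt' f (fun t => RInt f t b) t b); [|apply H].
  apply filter_forall. intro s. apply (RInt_correct f), ctn_ex_RInt, H.
Qed.

Lemma ctn_RInt (f : R -> R) (a : R) : ctn f -> ctn (fun t => RInt f a t).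
Proof. intros H. apply ctn_is_derive with f. intro t. now apply ctn_is_derive_RInt. Qed.

Lemma ctn_RInt_l (f : R -> R) (b : R) : ctn f -> ctn (fun t => RInt f t b).
Proof.
  intros H. apply ctn_is_derive with (fun t => - f t).
  intro t. now apply ctn_is_derive_RInt_l.
Qed.

#[local] Hint Resolve ctn_RInt ctn_RInt_l : ctn.

Lemma RInt_antideriv (F f : R -> R) (a b : R) :
  (forall t, is_derive F t (f t)) -> ctn f -> RInt f a b = F b - F a.
Proof.
  intros HF Hf. apply (is_RInt_unique f), (is_RInt_derive F f); auto.
Qed.

Lemma RInt_ext_all (f g : R -> R) (a b : R) :
  (forall t, f t = g t) -> RInt f a b = RInt g a b.
Proof. intros H. apply (RInt_ext f g). intros; apply H. Qed.

Lemma RInt_ext_on (f g : R -> R) (a b : R) : a <= b ->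
  (forall t, a < t < b -> f t = g t) -> RInt f a b = RInt g a b.
Proof.
  intros Hab H. apply (RInt_ext f g). rewrite Rmin_left, Rmax_right by easy. apply H.
Qed.

Lemma RInt_zero_on (f : R -> R) (a b : R) :
  a <= b -> (forall t, a < t < b -> f t = 0) -> RInt f a b = 0.
Proof.
  intros Hab H. rewrite (RInt_ext f (fun _ => 0)).
  - rewrite RInt_const. apply (@scal_zero_r R_Ring).
  - intros t. rewrite Rmin_left, Rmax_right by lra. apply H.
Qed.

Lemma RInt_ctn_minus (f g : R -> R) (a b : R) : ctn f -> ctn g ->
  RInt (fun t => f t - g t) a b = RInt f a b - RInt g a b.
Proof. intros Hf Hg. apply (RInt_minus f g); now apply ctn_ex_RInt. Qed.

Lemma RInt_ctn_plus (f g : R -> R) (a b : R) : ctn f -> ctn g ->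
  RInt (fun t => f t + g t) a b = RInt f a b + RInt g a b.
Proof. intros Hf Hg. apply (RInt_plus f g); now apply ctn_ex_RInt. Qed.

Lemma RInt_ctn_scal (c : R) (f : R -> R) (a b : R) : ctn f ->
  RInt (fun t => c * f t) a b = c * RInt f a b.
Proof. intros Hf. apply (RInt_scal f); now apply ctn_ex_RInt. Qed.

Lemma RInt_ctn_Chasles (f : R -> R) (a b c : R) : ctn f ->
  RInt f a b + RInt f b c = RInt f a c.
Proof. intros Hf. apply (RInt_Chasles f); now apply ctn_ex_RInt. Qed.

(** A positive value at an interior point persists on a subinterval, whose positive contribution the
    nonnegative rest cannot cancel. *)
Lemma ctn_zero_of_RInt_nonneg (f : R -> R) (a b : R) :
  ctn f -> (forall t, a <= t <= b -> 0 <= f t) -> RInt f a b = 0 ->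
  forall t, a < t < b -> f t = 0.
Proof.
  intros Hf Hpos H t Ht.
  destruct (Rle_lt_or_eq_dec 0 (f t)) as [Hft|Hft]; [apply Hpos; lra| |easy].
  exfalso.
  destruct (ctn_eps_inv f Hf t (f t) Hft) as [d [Hd Hs]].
  set (l := Rmax a (t - d / 2)). set (u := Rmin b (t + d / 2)).
  assert (Hl : a <= l < t) by (unfold l, Rmax; destruct Rle_dec; lra).
  assert (Hu : t < u <= b) by (unfold u, Rmin; destruct Rle_dec; lra).
  assert (Hl' : t - d / 2 <= l) by apply Rmax_r.
  assert (Hu' : u <= t + d / 2) by apply Rmin_r.
  rewrite <- (RInt_ctn_Chasles f a l b), <- (RInt_ctn_Chasles f l u b) in H by auto.
  assert (0 <= RInt f a l).
  { apply RInt_ge_0; [lra|now apply ctn_ex_RInt|]. intros; apply Hpos; lra. }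
  assert (0 <= RInt f u b).
  { apply RInt_ge_0; [lra|now apply ctn_ex_RInt|]. intros; apply Hpos; lra. }
  assert (0 < RInt f l u); [|lra].
  apply RInt_gt_0; [lra| |intros; apply Hf].
  intros s Hs1. assert (Rabs (s - t) < d) by (apply Rabs_def1; lra).
  specialize (Hs s H2). apply Rabs_def2 in Hs. lra.
Qed.

Lemma ctn_zero_closed (f : R -> R) (a b : R) : a < b ->
  ctn f -> (forall t, a < t < b -> f t = 0) -> forall t, a <= t <= b -> f t = 0.
Proof.
  intros Hab Hf H t Ht.
  destruct (Req_dec (f t) 0) as [|Hn]; [easy|exfalso].
  destruct (ctn_eps_inv f Hf t (Rabs (f t)) (Rabs_pos_lt _ Hn)) as [d [Hd Hs]].
  (* Move towards the farther endpoint by at most a quarter of the length, so that [s] is interior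
     even when [t] is an endpoint. *)
  set (s := if Rle_dec t ((a + b) / 2) then t + Rmin (d / 2) ((b - a) / 4)
            else t - Rmin (d / 2) ((b - a) / 4)).
  pose proof (Rmin_l (d / 2) ((b - a) / 4)). pose proof (Rmin_r (d / 2) ((b - a) / 4)).
  assert (0 < Rmin (d / 2) ((b - a) / 4)) by (apply Rmin_glb_lt; lra).
  assert (Hsi : a < s < b) by (unfold s; destruct Rle_dec; lra).
  assert (Hst : Rabs (s - t) < d).
  { unfold s; destruct Rle_dec; apply Rabs_def1; lra. }
  specialize (Hs s Hst). rewrite (H s Hsi) in Hs.
  rewrite Rminus_0_l, Rabs_Ropp in Hs. lra.
Qed.

(** * Parameter integrals *)

Definition ctn2 (f : R -> R -> R) : Prop := forall t s, continuity_2d_pt f t s.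

Lemma ctn2_section_r (f : R -> R -> R) (t : R) : ctn2 f -> ctn (f t).
Proof.
  intros H. apply ctn_eps. intros s eps He.
  destruct (H t s (mkposreal eps He)) as [d Hd].
  exists d. split; [apply cond_pos|]. intros u Hu. apply (Hd t u); [|easy].
  rewrite Rminus_diag, Rabs_R0. apply cond_pos.
Qed.

Lemma ctn2_swap (f : R -> R -> R) : ctn2 f -> ctn2 (fun s t => f t s).
Proof.
  intros H t s eps. destruct (H s t eps) as [d Hd].
  exists d. intros u v Hu Hv. now apply Hd.
Qed.

Lemma ctn2_comp (f : R -> R) (g : R -> R -> R) : ctn f -> ctn2 g -> ctn2 (fun t s => f (g t s)).
Proof.
  intros Hf Hg t s. apply continuity_1d_2d_pt_comp; [|apply Hg]. now apply ctn_pt.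
Qed.

Lemma ctn2_1 (f : R -> R) : ctn f -> ctn2 (fun t _ => f t).
Proof. intros Hf. apply (ctn2_comp f (fun t _ => t)); [easy|intros t s; apply continuity_2d_pt_id1]. Qed.

Lemma ctn2_2 (f : R -> R) : ctn f -> ctn2 (fun _ s => f s).
Proof. intros Hf. apply (ctn2_comp f (fun _ s => s)); [easy|intros t s; apply continuity_2d_pt_id2]. Qed.

Lemma ctn2_mult (f g : R -> R -> R) : ctn2 f -> ctn2 g -> ctn2 (fun t s => f t s * g t s).
Proof. intros Hf Hg t s. now apply continuity_2d_pt_mult. Qed.

Lemma ctn2_plus (f g : R -> R -> R) : ctn2 f -> ctn2 g -> ctn2 (fun t s => f t s + g t s).
Proof. intros Hf Hg t s. now apply continuity_2d_pt_plus. Qed.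

Lemma ctn2_minus (f g : R -> R -> R) : ctn2 f -> ctn2 g -> ctn2 (fun t s => f t s - g t s).
Proof. intros Hf Hg t s. now apply continuity_2d_pt_minus. Qed.

Lemma ctn_RInt_param (f : R -> R -> R) (c d : R) : c <= d ->
  ctn2 f -> ctn (fun t => RInt (f t) c d).
Proof.
  intros Hcd Hf. apply ctn_eps. intros t eps He.
  (* The [+ 1] keeps the divisor positive when [c = d] and makes the final bound strict. *)
  assert (He' : 0 < eps / (d - c + 1)) by (apply Rdiv_lt_0_compat; lra).
  destruct (uniform_continuity_2d f (t - 1) (t + 1) c d (fun x y _ _ => Hf x y)
              (mkposreal _ He')) as [del Hdel].
  exists (Rmin del 1). split; [apply Rmin_glb_lt; [apply cond_pos|lra]|].
  intros s Hs.
  assert (Hs1 := Rlt_le_trans _ _ _ Hs (Rmin_l _ _)).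
  assert (Hs2 := Rlt_le_trans _ _ _ Hs (Rmin_r _ _)).
  apply Rabs_def2 in Hs2.
  rewrite <- RInt_ctn_minus by now apply ctn2_section_r.
  apply Rle_lt_trans with ((d - c) * (eps / (d - c + 1))).
  - apply abs_RInt_le_const; [easy| |].
    + apply ctn_ex_RInt, ctn_minus; now apply ctn2_section_r.
    + intros y Hy. apply Rlt_le, (Hdel t y s y); try lra.
      rewrite Rminus_diag, Rabs_R0. apply cond_pos.
  - apply Rlt_le_trans with ((d - c + 1) * (eps / (d - c + 1))).
    + apply Rmult_lt_compat_r; lra.
    + right. field. lra.
Qed.

Lemma is_derive_RInt_param_ctn (f df : R -> R -> R) (c d t : R) :
  (forall t s, is_derive (fun u => f u s) t (df t s)) -> ctn2 df ->
  (forall t, ctn (f t)) ->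
  is_derive (fun t => RInt (f t) c d) t (RInt (df t) c d).
Proof.
  intros Hd Hdf Hf.
  assert (E : forall t s, Derive (fun u => f u s) t = df t s)
    by (intros; now apply is_derive_unique).
  rewrite <- (RInt_ext (fun s => Derive (fun u => f u s) t) (df t)) by (intros; apply E).
  apply is_derive_RInt_param.
  - apply filter_forall. intros x s _. now exists (df x s).
  - intros s _. apply continuity_2d_pt_ext with df; [|apply Hdf]. intros; now rewrite E.
  - apply filter_forall. intros y. now apply ctn_ex_RInt.
Qed.

(** Let the upper limit of the [x]-integral vary: differentiating under the integral sign shows that
    the right side, as the function [P], has the inner integral as derivative, so the left side is
    an increment of [P], and [P a = 0]. *)
Lemma RInt_Fubini (f : R -> R -> R) (a b c d : R) : a <= b -> c <= d -> ctn2 f ->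
  RInt (fun x => RInt (fun y => f x y) c d) a b
  = RInt (fun y => RInt (fun x => f x y) a b) c d.
Proof.
  intros Hab Hcd Hf. pose proof (ctn2_swap _ Hf) as Hf'.
  set (P := fun x => RInt (fun y => RInt (fun u => f u y) a x) c d).
  assert (HP : forall x, is_derive P x (RInt (f x) c d)).
  { intros x. apply (is_derive_RInt_param_ctn (fun x y => RInt (fun u => f u y) a x) f).
    - intros t s. apply (ctn_is_derive_RInt (fun u => f u s)). apply (ctn2_section_r _ s Hf').
    - easy.
    - intros t. destruct (Rle_dec a t).
      + now apply (ctn_RInt_param (fun y u => f u y)).
      + apply ctn_ext with (fun y => - RInt (fun u => f u y) t a).
        * intros y. apply (opp_RInt_swap (fun u => f u y)). apply ctn_ex_RInt.
          apply (ctn2_section_r _ y Hf').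
        * apply ctn_opp. apply (ctn_RInt_param (fun y u => f u y)); [lra|easy]. }
  rewrite (RInt_antideriv P); [|easy|now apply ctn_RInt_param].
  assert (P a = 0) as ->; [|apply Rminus_0_r].
  unfold P. apply RInt_zero_on; [easy|]. intros. rewrite RInt_point. reflexivity.
Qed.

(** * Improper integrals of weakly singular kernels *)

(* [s_+^p], continuous on the whole line for [p > 0]. *)
Definition pw (p s : R) : R := if Rle_dec s 0 then 0 else Rpower s p.

Lemma pw_neg (p s : R) : s <= 0 -> pw p s = 0.
Proof. intros H. unfold pw. destruct Rle_dec; [easy|lra]. Qed.

Lemma pw_pos (p s : R) : 0 < s -> pw p s = Rpower s p.
Proof. intros H. unfold pw. destruct Rle_dec; [lra|easy]. Qed.

Lemma pw_ge_0 (p s : R) : 0 <= pw p s.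
Proof. unfold pw. destruct Rle_dec; [lra|]. apply Rlt_le, exp_pos. Qed.

Lemma pw_le (p s t : R) : 0 < p -> s <= t -> pw p s <= pw p t.
Proof.
  intros Hp Hst. destruct (Rle_dec s 0) as [Hs|Hs].
  - rewrite (pw_neg p s Hs). apply pw_ge_0.
  - rewrite !pw_pos by lra. apply Rle_Rpower_l; lra.
Qed.

Lemma pw_inv (p s : R) : 0 < p -> 0 <= s -> pw (/ p) (pw p s) = s.
Proof.
  intros Hp Hs. destruct (Rle_lt_or_eq_dec 0 s Hs) as [Hs'|<-].
  - rewrite (pw_pos p s) by easy. rewrite pw_pos by apply exp_pos.
    rewrite Rpower_mult, Rinv_r, Rpower_1; lra.
  - rewrite (pw_neg p) by lra. apply pw_neg. lra.
Qed.

Lemma pw_is_derive (p s : R) : 0 < s -> is_derive (pw p) s (p * Rpower s (p - 1)).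
Proof.
  intros Hs. apply is_derive_ext_loc with (fun s => Rpower s p).
  - exists (mkposreal s Hs). intros y Hy. apply Rabs_def2 in Hy. simpl in Hy.
    symmetry. apply pw_pos. unfold minus, plus, opp in Hy; simpl in Hy. lra.
  - apply is_derive_Reals. now apply derivable_pt_lim_power.
Qed.

Lemma pw_ctn (p : R) : 0 < p -> ctn (pw p).
Proof.
  intros Hp t. destruct (Rlt_dec 0 t) as [Ht|Ht].
  { apply (ex_derive_continuous (pw p)). eexists. now apply pw_is_derive. }
  destruct (Req_dec t 0) as [->|Hn].
  - apply filterlim_locally. intros eps.
    (* The solution of [d^p = eps]. *)
    set (d := Rpower eps (/ p)).
    exists (mkposreal d (exp_pos _)). intros s Hs. apply Rabs_def2 in Hs.
    unfold minus, plus, opp in Hs; simpl in Hs.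
    apply Rabs_def1; unfold minus, plus, opp; simpl; rewrite (pw_neg p 0) by lra.
    + rewrite Ropp_0, Rplus_0_r. unfold pw. destruct Rle_dec; [apply cond_pos|].
      replace (pos eps) with (Rpower d p).
      * apply Rlt_Rpower_l; lra.
      * unfold d. rewrite Rpower_mult, Rinv_l, Rpower_1; [easy|apply cond_pos|lra].
    + pose proof (pw_ge_0 p s). pose proof (cond_pos eps). lra.
  - apply continuous_ext_loc with (fun _ => 0); [|apply continuous_const].
    assert (Hpos : 0 < - t) by lra.
    exists (mkposreal _ Hpos). intros s Hs. apply Rabs_def2 in Hs.
    unfold minus, plus, opp in Hs; simpl in Hs. symmetry. apply pw_neg. lra.
Qed.

(** The integrand may be unbounded at both ends: the fundamental theorem is applied on compact
    subintervals, and continuity of [F] at the endpoints gives the limit. *)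
Lemma is_RInt_gen_antideriv (F f : R -> R) (a b : R) : a < b -> ctn F ->
  (forall t, a < t < b -> is_derive F t (f t)) ->
  (forall t, a < t < b -> continuous f t) ->
  is_RInt_gen f (at_right a) (at_left b) (F b - F a).
Proof.
  intros Hab HF Hd Hf.
  (* The midpoint separates the two moving limits of integration, which keeps them in order. *)
  set (m := (a + b) / 2).
  assert (Hr : at_right a (fun x => a < x < m)).
  { assert (H : 0 < m - a) by (unfold m; lra). exists (mkposreal _ H).
    intros y Hy Hay. apply Rabs_def2 in Hy. unfold minus, plus, opp in Hy; simpl in Hy.
    lra. }
  assert (Hl : at_left b (fun x => m < x < b)).
  { assert (H : 0 < b - m) by (unfold m; lra). exists (mkposreal _ H).
    intros y Hy Hay. apply Rabs_def2 in Hy. unfold minus, plus, opp in Hy; simpl in Hy.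
    lra. }
  intros P HP.
  assert (HL : filterlim (fun ab : R * R => F (snd ab) - F (fst ab))
                 (filter_prod (at_right a) (at_left b)) (locally (F b - F a))).
  { eapply filterlim_comp_2 with (f := fun ab : R * R => F (snd ab)) (g := fun ab : R * R => - F (fst ab)) (h := Rplus).
    - apply (filterlim_comp _ _ _ snd F _ (at_left b) _ filterlim_snd).
      eapply filterlim_filter_le_1; [|apply HF]. apply filter_le_within.
    - apply (filterlim_comp _ _ _ fst (fun x => - F x) _ (at_right a) _ filterlim_fst).
      eapply filterlim_filter_le_1; [|apply (ctn_opp F HF)]. apply filter_le_within.
    - apply (filterlim_plus (F b) (- F a)). }
  specialize (HL P HP). unfold filtermap in HL.
  assert (HB : filter_prod (at_right a) (at_left b)
                 (fun ab => a < fst ab < m /\ m < snd ab < b)).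
  { apply (Filter_prod _ _ _ _ _ Hr Hl). intros; now split. }
  unfold filtermapi.
  generalize (filter_and _ _ HL HB). apply filter_imp. intros [u v] [HPu [Hu Hv]].
  simpl in *. exists (F v - F u). split; [|easy].
  apply (is_RInt_derive F f); intros x Hx; rewrite Rmin_left, Rmax_right in Hx by lra;
    [apply Hd|apply Hf]; lra.
Qed.

Lemma at_right_left_within (a b : R) (P : R -> Prop) : a < b ->
  (forall t, a < t < b -> P t) ->
  filter_prod (at_right a) (at_left b) (fun ab => forall x,
     Rmin (fst ab) (snd ab) < x < Rmax (fst ab) (snd ab) -> P x).
Proof.
  intros Hab H. assert (Hd : 0 < b - a) by lra.
  apply (Filter_prod _ _ _ (fun x => a < x < b) (fun x => a < x < b)).
  - exists (mkposreal _ Hd). intros y Hy Hay. apply Rabs_def2 in Hy.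
    unfold minus, plus, opp in Hy; simpl in Hy. lra.
  - exists (mkposreal _ Hd). intros y Hy Hay. apply Rabs_def2 in Hy.
    unfold minus, plus, opp in Hy; simpl in Hy. lra.
  - intros u v Hu Hv x Hx. simpl in Hx. apply H.
    destruct Hx. split.
    + apply Rlt_trans with (Rmin u v); [apply Rmin_glb_lt|]; tauto.
    + apply Rlt_trans with (Rmax u v); [|apply Rmax_lub_lt]; tauto.
Qed.

Lemma continuous_kernel_l (f : R -> R) (p t tau : R) : ctn f -> tau < t ->
  continuous (fun tau => Rpower (t - tau) p * f tau) tau.
Proof.
  intros Hf Ht. apply (continuous_mult (fun tau => Rpower (t - tau) p) f); [|apply Hf].
  apply (ex_derive_continuous (fun tau => Rpower (t - tau) p)).
  eexists. apply (is_derive_comp (fun s => Rpower s p) (fun tau => t - tau)).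
  - apply is_derive_Reals, derivable_pt_lim_power. lra.
  - auto_derive; [easy|reflexivity].
Qed.

Lemma continuous_kernel_r (f : R -> R) (p t tau : R) : ctn f -> t < tau ->
  continuous (fun tau => Rpower (tau - t) p * f tau) tau.
Proof.
  intros Hf Ht. apply (continuous_mult (fun tau => Rpower (tau - t) p) f); [|apply Hf].
  apply (ex_derive_continuous (fun tau => Rpower (tau - t) p)).
  eexists. apply (is_derive_comp (fun s => Rpower s p) (fun tau => tau - t)).
  - apply is_derive_Reals, derivable_pt_lim_power. lra.
  - auto_derive; [easy|reflexivity].
Qed.

(* Substitution [s = (t - tau)^beta] removes the singularity. *)
Lemma is_RInt_gen_kernel_l (f : R -> R) (beta a t : R) : 0 < beta -> a < t -> ctn f ->
  is_RInt_gen (fun tau => Rpower (t - tau) (beta - 1) * f tau) (at_right a) (at_left t)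
    (/ beta * RInt (fun s => f (t - pw (/ beta) s)) 0 (pw beta (t - a))).
Proof.
  intros Hb Hat Hf.
  assert (Hib : 0 < / beta) by now apply Rinv_0_lt_compat.
  set (k := fun s => f (t - pw (/ beta) s)).
  assert (Hk : ctn k).
  { apply (ctn_comp (fun s => t - pw (/ beta) s) f); auto using pw_ctn with ctn. }
  (* An antiderivative of the singular integrand: the chain rule brings out [(t - tau)^(beta - 1)],
     and [pw_inv] turns [k (pw beta (t - tau))] back into [f tau]. *)
  set (F := fun tau => - / beta * RInt k 0 (pw beta (t - tau))).
  replace (/ beta * _) with (F t - F a).
  2:{ unfold F. rewrite Rminus_diag, (pw_neg beta 0), RInt_point by lra.
      unfold zero; simpl. ring. }
  apply is_RInt_gen_antideriv; [easy| | |].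
  - apply ctn_mult; [auto with ctn|].
    apply (ctn_comp (fun tau => pw beta (t - tau)) (fun y => RInt k 0 y)); [|auto with ctn].
    apply (ctn_comp (fun tau => t - tau) (pw beta)); auto using pw_ctn with ctn.
  - intros tau Htau.
    replace (Rpower (t - tau) (beta - 1) * f tau)
      with (- / beta * ((- 1 * (beta * Rpower (t - tau) (beta - 1))) * k (pw beta (t - tau)))).
    + apply (is_derive_scal (fun tau => RInt k 0 (pw beta (t - tau)))).
      apply (is_derive_comp (fun y => RInt k 0 y) (fun tau => pw beta (t - tau))).
      * now apply ctn_is_derive_RInt.
      * apply (is_derive_comp (pw beta) (fun tau => t - tau)).
        -- apply pw_is_derive. lra.
        -- auto_derive; [easy|ring].
    + unfold k. rewrite pw_inv by lra. replace (t - (t - tau)) with tau by ring. field. lra.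
  - intros tau Htau. now apply continuous_kernel_l.
Qed.

Lemma is_RInt_gen_kernel_r (f : R -> R) (beta t b : R) : 0 < beta -> t < b -> ctn f ->
  is_RInt_gen (fun tau => Rpower (tau - t) (beta - 1) * f tau) (at_right t) (at_left b)
    (/ beta * RInt (fun s => f (t + pw (/ beta) s)) 0 (pw beta (b - t))).
Proof.
  intros Hb Hat Hf.
  assert (Hib : 0 < / beta) by now apply Rinv_0_lt_compat.
  set (k := fun s => f (t + pw (/ beta) s)).
  assert (Hk : ctn k).
  { apply (ctn_comp (fun s => t + pw (/ beta) s) f); auto using pw_ctn with ctn. }
  set (F := fun tau => / beta * RInt k 0 (pw beta (tau - t))).
  replace (/ beta * _) with (F b - F t).
  2:{ unfold F. rewrite Rminus_diag, (pw_neg beta 0), RInt_point by lra.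
      unfold zero; simpl. ring. }
  apply is_RInt_gen_antideriv; [easy| | |].
  - apply ctn_mult; [auto with ctn|].
    apply (ctn_comp (fun tau => pw beta (tau - t)) (fun y => RInt k 0 y)); [|auto with ctn].
    apply (ctn_comp (fun tau => tau - t) (pw beta)); auto using pw_ctn with ctn.
  - intros tau Htau.
    replace (Rpower (tau - t) (beta - 1) * f tau)
      with (/ beta * ((1 * (beta * Rpower (tau - t) (beta - 1))) * k (pw beta (tau - t)))).
    + apply (is_derive_scal (fun tau => RInt k 0 (pw beta (tau - t)))).
      apply (is_derive_comp (fun y => RInt k 0 y) (fun tau => pw beta (tau - t))).
      * now apply ctn_is_derive_RInt.
      * apply (is_derive_comp (pw beta) (fun tau => tau - t)).
        -- apply pw_is_derive. lra.
        -- auto_derive; [easy|ring].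
    + unfold k. rewrite pw_inv by lra. replace (t + (tau - t)) with tau by ring. field. lra.
  - intros tau Htau. now apply continuous_kernel_r.
Qed.

(* [beta] times the left kernel integral of [w], for [w] vanishing on [(-oo, a]]. *)
Definition lker (beta a b : R) (w : R -> R) (t : R) : R :=
  RInt (fun s => w (t - pw (/ beta) s)) 0 (pw beta (b - a)).

(** Values of [s] beyond [(t - a)^beta] correspond to arguments at most [a], where [w] vanishes.
    This is why [lker] can have an upper limit independent of [t], so that differentiating it only
    touches the integrand. *)
Lemma lker_eq (beta a b : R) (w : R -> R) (t : R) :
  0 < beta -> a <= t <= b -> ctn w -> (forall s, s <= a -> w s = 0) ->
  lker beta a b w t = RInt (fun s => w (t - pw (/ beta) s)) 0 (pw beta (t - a)).
Proof.
  intros Hb Ht Hw H0. unfold lker.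
  assert (Hib : 0 < / beta) by now apply Rinv_0_lt_compat.
  assert (Hk : ctn (fun s => w (t - pw (/ beta) s))).
  { apply (ctn_comp (fun s => t - pw (/ beta) s) w); auto using pw_ctn with ctn. }
  rewrite <- (RInt_ctn_Chasles _ 0 (pw beta (t - a)) _ Hk).
  rewrite (RInt_zero_on _ (pw beta (t - a))); [ring| |].
  - apply pw_le; lra.
  - intros s Hs. apply H0.
    assert (t - a <= pw (/ beta) s); [|lra].
    rewrite <- (pw_inv beta (t - a)) by lra. apply pw_le; lra.
Qed.

Lemma lker_ctn (beta a b : R) (w : R -> R) : 0 < beta -> ctn w -> ctn (lker beta a b w).
Proof.
  intros Hb Hw. apply (ctn_RInt_param (fun t s => w (t - pw (/ beta) s))); [apply pw_ge_0|].
  apply (ctn2_comp w); [easy|]. apply ctn2_minus.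
  - apply (ctn2_1 (fun t => t)). auto with ctn.
  - apply (ctn2_2 (pw (/ beta))), pw_ctn. now apply Rinv_0_lt_compat.
Qed.

Lemma lker_is_derive (beta a b : R) (w dw : R -> R) (t : R) : 0 < beta ->
  (forall t, is_derive w t (dw t)) -> ctn dw ->
  is_derive (lker beta a b w) t (lker beta a b dw t).
Proof.
  intros Hb Hw Hdw.
  assert (Hib : 0 < / beta) by now apply Rinv_0_lt_compat.
  apply (is_derive_RInt_param_ctn (fun t s => w (t - pw (/ beta) s))
           (fun t s => dw (t - pw (/ beta) s))).
  - intros x s. replace (dw (x - pw (/ beta) s)) with (1 * dw (x - pw (/ beta) s)) by ring.
    apply (is_derive_comp w (fun u => u - pw (/ beta) s)); [apply Hw|].
    auto_derive; [easy|ring].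
  - apply (ctn2_comp dw); [easy|]. apply ctn2_minus.
    + apply (ctn2_1 (fun t => t)). auto with ctn.
    + apply (ctn2_2 (pw (/ beta))). now apply pw_ctn.
  - intros x. apply (ctn_comp (fun s => x - pw (/ beta) s) w).
    + auto using pw_ctn with ctn.
    + now apply ctn_is_derive with dw.
Qed.

(* [beta] times the right kernel integral over [(t,b)] of a [g] that is constant
   on [[b, oo)]; subtracting [g b] makes the integrand vanish there. *)
Definition rker (beta a b : R) (g : R -> R) (t : R) : R :=
  RInt (fun s => g (t + pw (/ beta) s) - g b) 0 (pw beta (b - a)) + g b * pw beta (b - t).

Lemma rker_eq (beta a b : R) (g : R -> R) (t : R) :
  0 < beta -> a <= t <= b -> ctn g -> (forall s, b <= s -> g s = g b) ->
  rker beta a b g t = RInt (fun s => g (t + pw (/ beta) s)) 0 (pw beta (b - t)).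
Proof.
  intros Hb Ht Hg H0. unfold rker.
  assert (Hib : 0 < / beta) by now apply Rinv_0_lt_compat.
  assert (Hk : ctn (fun s => g (t + pw (/ beta) s))).
  { apply (ctn_comp (fun s => t + pw (/ beta) s) g); auto using pw_ctn with ctn. }
  rewrite <- (RInt_ctn_Chasles _ 0 (pw beta (b - t)) (pw beta (b - a))) by auto with ctn.
  rewrite (RInt_zero_on _ (pw beta (b - t))).
  - rewrite RInt_ctn_minus by auto with ctn. rewrite RInt_const.
    unfold scal; simpl; unfold mult; simpl. ring.
  - apply pw_le; lra.
  - intros s Hs. rewrite H0; [ring|].
    assert (b - t <= pw (/ beta) s); [|lra].
    rewrite <- (pw_inv beta (b - t)) by lra. apply pw_le; lra.
Qed.

Lemma ctn2_rker (beta b : R) (g : R -> R) : 0 < beta -> ctn g ->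
  ctn2 (fun t s => g (t + pw (/ beta) s) - g b).
Proof.
  intros Hb Hg. apply (ctn2_comp (fun y => g y - g b)); [auto with ctn|].
  apply (ctn2_plus (fun t _ => t) (fun _ s => pw (/ beta) s)).
  - apply (ctn2_1 (fun t => t)). auto with ctn.
  - apply (ctn2_2 (pw (/ beta))), pw_ctn. now apply Rinv_0_lt_compat.
Qed.

Lemma rker_ctn (beta a b : R) (g : R -> R) : 0 < beta -> ctn g -> ctn (rker beta a b g).
Proof.
  intros Hb Hg. apply ctn_plus.
  - apply (ctn_RInt_param (fun t s => g (t + pw (/ beta) s) - g b)); [apply pw_ge_0|].
    now apply ctn2_rker.
  - apply ctn_mult; [auto with ctn|].
    apply (ctn_comp (fun t => b - t) (pw beta)); auto using pw_ctn with ctn.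
Qed.

(** The case of a constant [g] in the fractional integration by parts. With [W] an antiderivative of
    [w], [lker W] is one of [lker w], so the left side is [lker W] at [b]; its singular integral is
    then computed a second time by ordinary parts. *)
Lemma lker_antideriv_at_b (beta a b : R) (w : R -> R) :
  0 < beta -> a < b -> ctn w -> (forall s, s <= a -> w s = 0) ->
  RInt (lker beta a b w) a b = RInt (fun t => w t * pw beta (b - t)) a b.
Proof.
  intros Hb Hab Hw H0.
  assert (Hib : 0 < / beta) by now apply Rinv_0_lt_compat.
  set (W := fun t => RInt w a t).
  assert (HW : forall t, is_derive W t (w t)) by (intros; now apply ctn_is_derive_RInt).
  assert (HWc : ctn W) by (unfold W; auto with ctn).
  assert (HW0 : forall s, s <= a -> W s = 0).
  { intros s Hs. unfold W. rewrite <- (opp_RInt_swap w) by now apply ctn_ex_RInt.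
    rewrite RInt_zero_on; [apply Ropp_0|easy|]. intros; apply H0; lra. }
  rewrite (RInt_antideriv (lker beta a b W)); [| |now apply lker_ctn].
  2:{ intros t. now apply lker_is_derive. }
  assert (lker beta a b W a = 0) as ->.
  { unfold lker. apply RInt_zero_on; [apply pw_ge_0|]. intros s _. apply HW0.
    pose proof (pw_ge_0 (/ beta) s). lra. }
  rewrite lker_eq by (auto; lra).
  pose proof (is_RInt_gen_kernel_l W beta a b Hb Hab HWc) as H1.
  apply (is_RInt_gen_unique (V := R_CompleteNormedModule)) in H1.
  set (k := fun t => w t * pw beta (b - t)).
  assert (Hk : ctn k).
  { apply ctn_mult; [easy|].
    apply (ctn_comp (fun t => b - t) (pw beta)); auto using pw_ctn with ctn. }
  (* Integration by parts as an explicit antiderivative. Its boundary term vanishes at both ends: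
     the power is zero at [b], and [W] is zero at [a]. *)
  set (F := fun t => / beta * (RInt k a t - pw beta (b - t) * W t)).
  assert (H2 : is_RInt_gen (fun tau => Rpower (b - tau) (beta - 1) * W tau)
                 (at_right a) (at_left b) (F b - F a)).
  { apply is_RInt_gen_antideriv; [easy| | |].
    - apply ctn_mult; [auto with ctn|]. apply ctn_minus; [auto with ctn|].
      apply ctn_mult; [|easy].
      apply (ctn_comp (fun t => b - t) (pw beta)); auto using pw_ctn with ctn.
    - intros t Ht.
      replace (Rpower (b - t) (beta - 1) * W t) with
        (/ beta * (k t - ((- 1 * (beta * Rpower (b - t) (beta - 1))) * W t
                          + pw beta (b - t) * w t))).
      + apply (is_derive_scal (fun t => RInt k a t - pw beta (b - t) * W t)).
        apply (is_derive_minus (fun t => RInt k a t) (fun t => pw beta (b - t) * W t)).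
        * now apply ctn_is_derive_RInt.
        * apply (is_derive_mult (fun t => pw beta (b - t)) W); [|apply HW|intros; apply Rmult_comm].
          apply (is_derive_comp (pw beta) (fun t => b - t)).
          -- apply pw_is_derive. lra.
          -- auto_derive; [easy|ring].
      + unfold k. field. lra.
    - intros t Ht. now apply continuous_kernel_l. }
  apply (is_RInt_gen_unique (V := R_CompleteNormedModule)) in H2.
  rewrite H1 in H2.
  apply Rmult_eq_reg_l with (/ beta); [|lra].
  rewrite Rminus_0_r, H2. unfold F.
  rewrite Rminus_diag, (pw_neg beta 0) by lra. rewrite (HW0 a), RInt_point by lra.
  unfold zero; simpl. ring.
Qed.

(** * Fractional integration by parts *)

(** After Fubini, a fixed [s] leaves the two functions paired at distance [r = s^(1/beta)], and the
    identity is the translation [t -> t + r]. For this [g] must vanish beyond [b], so [g b] is split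
    off and treated by [lker_antideriv_at_b]. *)
Lemma frac_int_by_parts (beta a b : R) (g w : R -> R) :
  0 < beta -> a < b -> ctn g -> (forall s, b <= s -> g s = g b) ->
  ctn w -> (forall s, s <= a -> w s = 0) ->
  RInt (fun t => g t * lker beta a b w t) a b = RInt (fun t => w t * rker beta a b g t) a b.
Proof.
  intros Hb Hab Hg Hg0 Hw Hw0.
  assert (Hib : 0 < / beta) by now apply Rinv_0_lt_compat.
  assert (Hpr := pw_ctn (/ beta) Hib).
  set (M := pw beta (b - a)). assert (HM : 0 <= M) by apply pw_ge_0.
  set (g0 := fun t => g t - g b).
  assert (Hg0c : ctn g0) by (unfold g0; auto with ctn).
  set (K := fun t => RInt (fun s => g0 (t + pw (/ beta) s)) 0 M).
  assert (HK : ctn K).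
  { apply (ctn_RInt_param (fun t s => g0 (t + pw (/ beta) s))); [easy|]. now apply ctn2_rker. }
  assert (Hl := lker_ctn beta a b w Hb Hw).
  assert (Hpb : ctn (fun t => pw beta (b - t))).
  { apply (ctn_comp (fun t => b - t) (pw beta)); auto using pw_ctn with ctn. }
  assert (Hw2 : ctn2 (fun t s => w (t - pw (/ beta) s))).
  { apply (ctn2_comp w); [easy|]. apply ctn2_minus.
    - apply (ctn2_1 (fun t => t)). auto with ctn.
    - now apply (ctn2_2 (pw (/ beta))). }
  transitivity (RInt (fun t => g0 t * lker beta a b w t) a b + g b * RInt (lker beta a b w) a b).
  { rewrite <- RInt_ctn_scal, <- RInt_ctn_plus by auto with ctn.
    apply RInt_ext_all. intros t. unfold g0. ring. }
  transitivity (RInt (fun t => w t * K t) a b + g b * RInt (fun t => w t * pw beta (b - t)) a b).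
  2:{ rewrite <- RInt_ctn_scal, <- RInt_ctn_plus by auto with ctn.
    apply RInt_ext_all. intros t. unfold rker, K, M, g0. ring. }
  f_equal; [|now rewrite lker_antideriv_at_b].
  transitivity (RInt (fun t => RInt (fun s => g0 t * w (t - pw (/ beta) s)) 0 M) a b).
  { apply RInt_ext_all. intros t. unfold lker. symmetry. apply RInt_ctn_scal.
    now apply (ctn2_section_r _ t Hw2). }
  transitivity (RInt (fun t => RInt (fun s => w t * g0 (t + pw (/ beta) s)) 0 M) a b).
  2:{ apply RInt_ext_all. intros t. unfold K. apply RInt_ctn_scal.
    apply (ctn2_section_r (fun t s => g0 (t + pw (/ beta) s)) t). now apply ctn2_rker. }
  rewrite (RInt_Fubini (fun t s => g0 t * w (t - pw (/ beta) s))); [|lra|easy|].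
  2:{ apply ctn2_mult; [now apply (ctn2_1 g0)|easy]. }
  rewrite (RInt_Fubini (fun t s => w t * g0 (t + pw (/ beta) s))); [|lra|easy|].
  2:{ apply ctn2_mult; [now apply (ctn2_1 w)|now apply ctn2_rker]. }
  apply RInt_ext_all. intros s. set (r := pw (/ beta) s).
  assert (Hr : 0 <= r) by apply pw_ge_0.
  set (k := fun t => w t * g0 (t + r)).
  assert (Hk : ctn k).
  { apply ctn_mult; [easy|]. apply (ctn_comp (fun t => t + r) g0); auto with ctn. }
  transitivity (RInt k (a - r) (b - r)).
  - pose proof (RInt_comp_lin k 1 (- r) a b (ctn_ex_RInt _ _ _ Hk)) as E.
    replace (1 * a + - r) with (a - r) in E by ring.
    replace (1 * b + - r) with (b - r) in E by ring.
    rewrite <- E. apply RInt_ext_all. intros t. unfold scal; simpl; unfold mult; simpl.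
    unfold k. replace (1 * t + - r) with (t - r) by ring.
    replace (t - r + r) with t by ring. ring.
  (* The translated range [[a - r, b - r]] may be replaced by [[a, b]]: [w] vanishes on
     [[a - r, a]], and [g0 (t + r)] on [[b - r, b]]. *)
  - rewrite <- (RInt_ctn_Chasles k (a - r) a) by easy.
    rewrite (RInt_zero_on k (a - r) a); [|lra|].
    2:{ intros t Ht. unfold k. rewrite Hw0 by lra. ring. }
    rewrite <- (RInt_ctn_Chasles k a (b - r) b) by easy.
    rewrite (RInt_zero_on k (b - r) b); [ring|lra|].
    intros t Ht. unfold k, g0. rewrite (Hg0 (t + r)) by lra. ring.
Qed.

(** * Iterated integrals *)

Fixpoint iint (a : R) (u : R -> R) (k : nat) : R -> R :=
  match k with
  | O => u
  | S k' => fun t => RInt (iint a u k') a t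
  end.

Fixpoint bint (b : R) (v : R -> R) (k : nat) : R -> R :=
  match k with
  | O => v
  | S k' => fun t => RInt (bint b v k') t b
  end.

Lemma iint_ctn (a : R) (u : R -> R) (k : nat) : ctn u -> ctn (iint a u k).
Proof. intros Hu. induction k; simpl; auto with ctn. Qed.

Lemma bint_ctn (b : R) (v : R -> R) (k : nat) : ctn v -> ctn (bint b v k).
Proof. intros Hv. induction k; simpl; auto with ctn. Qed.

Lemma iint_is_derive (a : R) (u : R -> R) (k : nat) (t : R) :
  ctn u -> is_derive (iint a u (S k)) t (iint a u k t).
Proof. intros Hu. apply (ctn_is_derive_RInt (iint a u k)). now apply iint_ctn. Qed.

Lemma bint_is_derive (b : R) (v : R -> R) (k : nat) (t : R) :
  ctn v -> is_derive (bint b v (S k)) t (- bint b v k t).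
Proof. intros Hv. apply (ctn_is_derive_RInt_l (bint b v k)). now apply bint_ctn. Qed.

Lemma iint_vanish (a : R) (u : R -> R) (k : nat) :
  ctn u -> (forall s, s <= a -> u s = 0) -> forall s, s <= a -> iint a u k s = 0.
Proof.
  intros Hu H0. induction k; [easy|]. intros s Hs. simpl.
  rewrite <- (opp_RInt_swap (iint a u k)) by now apply ctn_ex_RInt, iint_ctn.
  rewrite RInt_zero_on; [apply Ropp_0|easy|]. intros; apply IHk; lra.
Qed.

Lemma bint_at_end (b : R) (v : R -> R) (k : nat) : bint b v (S k) b = 0.
Proof. simpl. rewrite RInt_point. reflexivity. Qed.

Lemma iint_0 (a : R) (k : nat) : iint a (fun _ => 0) k = fun _ => 0.
Proof.
  induction k; [easy|]. simpl. rewrite IHk. apply functional_extensionality. intros t.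
  rewrite RInt_const. apply (@scal_zero_r R_Ring).
Qed.

Lemma iint_add (a : R) (u : R -> R) (j k : nat) : iint a u (j + k) = iint a (iint a u k) j.
Proof. induction j; [easy|]. simpl. now rewrite IHj. Qed.

(** Each integration by parts is free of boundary terms, since [iint] of positive order vanishes at
    [a] and [bint] of positive order at [b]. *)
Lemma iint_bint_dual (a b : R) (u v : R -> R) (k : nat) : ctn u -> ctn v ->
  RInt (fun t => v t * iint a u k t) a b = RInt (fun t => bint b v k t * u t) a b.
Proof.
  intros Hu Hv. revert v Hv. induction k; intros v Hv; [easy|].
  assert (Hik := iint_ctn a u k Hu). assert (HiS := iint_ctn a u (S k) Hu).
  assert (Hb1 := bint_ctn b v 1 Hv).
  transitivity (RInt (fun t => bint b v 1 t * iint a u k t) a b).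
  - apply Rminus_diag_uniq. rewrite <- RInt_ctn_minus by auto with ctn.
    rewrite (RInt_antideriv (fun t => - (bint b v 1 t * iint a u (S k) t))).
    + rewrite bint_at_end. simpl (iint a u (S k) a). rewrite RInt_point.
      unfold zero; simpl. ring.
    + intros t.
      replace (v t * iint a u (S k) t - bint b v 1 t * iint a u k t) with
        (- (- v t * iint a u (S k) t + bint b v 1 t * iint a u k t)) by ring.
      apply (is_derive_opp (fun t => bint b v 1 t * iint a u (S k) t)).
      apply (is_derive_mult (bint b v 1) (iint a u (S k))).
      * apply (bint_is_derive b v 0 t Hv).
      * now apply iint_is_derive.
      * intros; apply Rmult_comm.
    + auto with ctn.
  (* What remains is that one step towards [b] followed by [k] more makes [S k] steps. *)
  - rewrite IHk by easy. apply RInt_ext_all. intros t. f_equal.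
    clear. revert t. induction k; intros t; [easy|].
    simpl. apply RInt_ext_all. apply IHk.
Qed.

(** Duality moves the integrations onto [Q], so [bint b Q k] is orthogonal to every admissible [u].
    Testing with itself times [(t - a)_+], a weight that enforces vanishing up to [a] and is
    positive inside, shows that it is zero; [k] differentiations lead back to [Q]. *)
Lemma fundamental_lemma_iint (a b : R) (Q : R -> R) (k : nat) : a < b -> ctn Q ->
  (forall u, ctn u -> (forall s, s <= a -> u s = 0) ->
     RInt (fun t => Q t * iint a u k t) a b = 0) ->
  forall t, a <= t <= b -> Q t = 0.
Proof.
  intros Hab HQ H.
  assert (HB := fun j => bint_ctn b Q j HQ).
  assert (HBk : forall t, a <= t <= b -> bint b Q k t = 0).
  { apply ctn_zero_closed; auto. intros t Ht.
    assert (Hp : ctn (fun t => pw 1 (t - a))).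
    { apply (ctn_comp (fun t => t - a) (pw 1)); [auto with ctn|]. apply pw_ctn; lra. }
    assert (E := H (fun t => pw 1 (t - a) * bint b Q k t)).
    rewrite iint_bint_dual in E; auto with ctn.
    assert (E' : bint b Q k t * (pw 1 (t - a) * bint b Q k t) = 0).
    { apply (ctn_zero_of_RInt_nonneg
               (fun t => bint b Q k t * (pw 1 (t - a) * bint b Q k t)) a b);
        auto with ctn.
      - intros s _. pose proof (pw_ge_0 1 (s - a)). pose proof (Rle_0_sqr (bint b Q k s)).
        unfold Rsqr in *.
        replace (_ * _) with (pw 1 (s - a) * (bint b Q k s * bint b Q k s)) by ring.
        now apply Rmult_le_pos.
      - apply E; auto with ctn. intros s Hs. rewrite pw_neg by lra. ring. }
    rewrite pw_pos, Rpower_1 in E' by lra.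
    apply Rmult_integral in E' as [E'|E']; [easy|].
    apply Rmult_integral in E' as [E'|E']; [lra|easy]. }
  clear H. revert HBk. induction k; [easy|]. intros HS. apply IHk.
  apply ctn_zero_closed; auto. intros t Ht.
  assert (D1 := bint_is_derive b Q k t HQ). apply is_derive_unique in D1.
  assert (D2 : is_derive (bint b Q (S k)) t 0).
  { apply is_derive_ext_loc with (fun _ => 0); [|apply (is_derive_const 0)].
    assert (Hd : 0 < Rmin (t - a) (b - t)) by (apply Rmin_glb_lt; lra).
    exists (mkposreal _ Hd). intros s Hs. apply Rabs_def2 in Hs.
    unfold minus, plus, opp in Hs; simpl in Hs.
    pose proof (Rmin_l (t - a) (b - t)). pose proof (Rmin_r (t - a) (b - t)).
    symmetry. apply HS. lra. }
  apply is_derive_unique in D2. rewrite D2 in D1. lra.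
Qed.

(** * One-sided calculus on [[a, b]] *)

Definition clamp (a b t : R) : R := Rmax a (Rmin b t).

Lemma clamp_in (a b t : R) : a <= b -> a <= clamp a b t <= b.
Proof. intros. unfold clamp, Rmax, Rmin. repeat destruct Rle_dec; lra. Qed.

Lemma clamp_id (a b t : R) : a <= t <= b -> clamp a b t = t.
Proof. intros. unfold clamp, Rmax, Rmin. repeat destruct Rle_dec; lra. Qed.

Lemma clamp_ge (a b t : R) : a <= b -> b <= t -> clamp a b t = b.
Proof. intros. unfold clamp, Rmax, Rmin. repeat destruct Rle_dec; lra. Qed.

Lemma clamp_lip (a b s t : R) : Rabs (clamp a b s - clamp a b t) <= Rabs (s - t).
Proof.
  unfold clamp, Rmax, Rmin, Rabs.
  repeat destruct Rle_dec; repeat destruct Rcase_abs; lra.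
Qed.

Lemma cont_on_eps (a b : R) (f : R -> R) : cont_on a b f <->
  forall t, a <= t <= b -> forall eps, 0 < eps -> exists d, 0 < d /\
    forall s, a <= s <= b -> Rabs (s - t) < d -> Rabs (f s - f t) < eps.
Proof.
  split.
  - intros H t Ht eps He.
    destruct (proj1 (filterlim_locally _ _) (H t Ht) (mkposreal eps He)) as [d Hd].
    exists d. split; [apply cond_pos|]. intros s Hs Hst. now apply (Hd s Hst).
  - intros H t Ht. apply filterlim_locally. intros eps.
    destruct (H t Ht eps (cond_pos eps)) as [d [Hd Hs]].
    exists (mkposreal d Hd). intros s Hst Hin. now apply Hs.
Qed.

Lemma cont_on_clamp (a b : R) (f : R -> R) : a <= b ->
  cont_on a b f -> ctn (fun t => f (clamp a b t)).
Proof.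
  intros Hab Hf. apply ctn_eps. intros t eps He.
  destruct (proj1 (cont_on_eps a b f) Hf (clamp a b t) (clamp_in a b t Hab) eps He)
    as [d [Hd Hs]].
  exists d. split; [easy|]. intros s Hst. apply Hs; [now apply clamp_in|].
  eapply Rle_lt_trans; [apply clamp_lip|easy].
Qed.

Lemma cont_on_of_ctn (a b : R) (f F : R -> R) :
  ctn F -> (forall t, a <= t <= b -> f t = F t) -> cont_on a b f.
Proof.
  intros HF E. apply cont_on_eps. intros t Ht eps He.
  destruct (ctn_eps_inv F HF t eps He) as [d [Hd Hs]].
  exists d. split; [easy|]. intros s Hin Hst. rewrite !E by easy. now apply Hs.
Qed.

(** Multiplied out and with a weak inequality, the condition also holds at [s = t], so that point
    needs no exclusion. *)
Lemma is_deriv_in_eps (a b : R) (f : R -> R) (t l : R) : is_deriv_in a b f t l <->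
  forall eps, 0 < eps -> exists d, 0 < d /\
    forall s, a <= s <= b -> Rabs (s - t) < d ->
      Rabs (f s - f t - l * (s - t)) <= eps * Rabs (s - t).
Proof.
  split.
  - intros H eps He.
    destruct (proj1 (filterlim_locally _ _) H (mkposreal eps He)) as [d Hd].
    exists d. split; [apply cond_pos|]. intros s Hs Hst.
    destruct (Req_dec s t) as [->|Hn].
    { rewrite !Rminus_diag, Rmult_0_r, Rminus_diag, Rabs_R0. lra. }
    assert (Hq : Rabs ((f s - f t) / (s - t) - l) < eps) by now apply (Hd s Hst).
    replace (f s - f t - l * (s - t)) with (((f s - f t) / (s - t) - l) * (s - t)).
    + rewrite Rabs_mult. apply Rmult_le_compat_r; [apply Rabs_pos|lra].
    + field. lra.
  - intros H. apply filterlim_locally. intros eps.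
    destruct (H (eps / 2)) as [d [Hd Hs]].
    { pose proof (cond_pos eps). lra. }
    exists (mkposreal d Hd). intros s Hst [Hin Hn].
    specialize (Hs s Hin Hst).
    change (Rabs ((f s - f t) / (s - t) - l) < eps).
    assert (Hp : 0 < Rabs (s - t)) by (apply Rabs_pos_lt; lra).
    replace ((f s - f t) / (s - t) - l) with ((f s - f t - l * (s - t)) / (s - t))
      by (field; lra).
    unfold Rdiv. rewrite Rabs_mult, Rabs_inv.
    apply Rmult_lt_reg_r with (Rabs (s - t)); [easy|].
    rewrite Rmult_assoc, Rinv_l, Rmult_1_r by lra.
    pose proof (cond_pos eps). nra.
Qed.

Lemma is_deriv_in_cont (a b : R) (f : R -> R) (df : R -> R) :
  (forall t, a <= t <= b -> is_deriv_in a b f t (df t)) -> cont_on a b f.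
Proof.
  intros H. apply cont_on_eps. intros t Ht eps He.
  destruct (proj1 (is_deriv_in_eps _ _ _ _ _) (H t Ht) 1 Rlt_0_1) as [d [Hd Hs]].
  set (K := 1 + Rabs (df t)).
  assert (HK : 0 < K) by (unfold K; pose proof (Rabs_pos (df t)); lra).
  exists (Rmin d (eps / K)). split.
  { apply Rmin_glb_lt; [easy|]. now apply Rdiv_lt_0_compat. }
  intros s Hin Hst.
  specialize (Hs s Hin (Rlt_le_trans _ _ _ Hst (Rmin_l _ _))).
  assert (Hst' := Rlt_le_trans _ _ _ Hst (Rmin_r _ _)).
  apply Rle_lt_trans with (K * Rabs (s - t)).
  - replace (f s - f t) with ((f s - f t - df t * (s - t)) + df t * (s - t)) by ring.
    eapply Rle_trans; [apply Rabs_triang|]. rewrite Rabs_mult. unfold K. lra.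
  - apply Rmult_lt_reg_r with (/ K); [now apply Rinv_0_lt_compat|].
    replace (K * Rabs (s - t) * / K) with (Rabs (s - t)) by (field; lra). easy.
Qed.

Lemma is_deriv_in_of_is_derive (a b : R) (f F : R -> R) (t l : R) : a <= t <= b ->
  (forall s, a <= s <= b -> f s = F s) -> is_derive F t l -> is_deriv_in a b f t l.
Proof.
  intros Ht E HF. apply is_deriv_in_eps. intros eps He.
  apply is_derive_Reals in HF. destruct (HF eps He) as [d Hd].
  exists d. split; [apply cond_pos|]. intros s Hs Hst. rewrite !E by easy.
  destruct (Req_dec s t) as [->|Hn].
  { rewrite !Rminus_diag, Rmult_0_r, Rminus_diag, Rabs_R0. lra. }
  specialize (Hd (s - t) ltac:(lra) Hst).
  replace (t + (s - t)) with s in Hd by ring.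
  replace (F s - F t - l * (s - t)) with (((F s - F t) / (s - t) - l) * (s - t))
    by (field; lra).
  rewrite Rabs_mult. apply Rmult_le_compat_r; [apply Rabs_pos|lra].
Qed.

Lemma is_derive_of_is_deriv_in (a b : R) (f : R -> R) (t l : R) : a < t < b ->
  is_deriv_in a b f t l -> is_derive f t l.
Proof.
  intros Ht H. apply is_derive_Reals. intros eps He.
  destruct (proj1 (is_deriv_in_eps _ _ _ _ _) H (eps / 2)) as [d [Hd Hs]]; [lra|].
  assert (Hm : 0 < Rmin d (Rmin (t - a) (b - t))) by (repeat apply Rmin_glb_lt; lra).
  exists (mkposreal _ Hm). intros h Hh0 Hh. simpl in Hh.
  assert (H1 := Rlt_le_trans _ _ _ Hh (Rmin_l _ _)).
  assert (H2 := Rlt_le_trans _ _ _ Hh (Rmin_r _ _)).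
  assert (H3 := Rlt_le_trans _ _ _ H2 (Rmin_l _ _)).
  assert (H4 := Rlt_le_trans _ _ _ H2 (Rmin_r _ _)).
  apply Rabs_def2 in H3. apply Rabs_def2 in H4.
  specialize (Hs (t + h)). replace (t + h - t) with h in Hs by ring.
  specialize (Hs ltac:(lra) H1).
  assert (Hp : 0 < Rabs h) by now apply Rabs_pos_lt.
  replace ((f (t + h) - f t) / h - l) with ((f (t + h) - f t - l * h) / h) by (field; lra).
  unfold Rdiv. rewrite Rabs_mult, Rabs_inv.
  apply Rmult_lt_reg_r with (Rabs h); [easy|].
  rewrite Rmult_assoc, Rinv_l, Rmult_1_r by lra. nra.
Qed.

Lemma is_derive_clamp_of_is_deriv_in (a b : R) (f : R -> R) (t l : R) : a < t < b ->
  is_deriv_in a b f t l -> is_derive (fun t => f (clamp a b t)) t l.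
Proof.
  intros Ht H. apply is_derive_ext_loc with f; [|now apply is_derive_of_is_deriv_in in H].
  assert (Hd : 0 < Rmin (t - a) (b - t)) by (apply Rmin_glb_lt; lra).
  exists (mkposreal _ Hd). intros s Hs. apply Rabs_def2 in Hs.
  unfold minus, plus, opp in Hs; simpl in Hs.
  pose proof (Rmin_l (t - a) (b - t)). pose proof (Rmin_r (t - a) (b - t)).
  rewrite clamp_id; [easy|lra].
Qed.

Lemma is_deriv_in_lin (a b e : R) (f g : R -> R) (t lf lg : R) :
  is_deriv_in a b f t lf -> is_deriv_in a b g t lg ->
  is_deriv_in a b (fun t => f t + e * g t) t (lf + e * lg).
Proof.
  intros Hf Hg. apply is_deriv_in_eps. intros eps He.
  assert (HE : 0 < 1 + Rabs e) by (pose proof (Rabs_pos e); lra).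
  assert (He' : 0 < eps / (1 + Rabs e)) by now apply Rdiv_lt_0_compat.
  destruct (proj1 (is_deriv_in_eps _ _ _ _ _) Hf _ He') as [d1 [Hd1 H1]].
  destruct (proj1 (is_deriv_in_eps _ _ _ _ _) Hg _ He') as [d2 [Hd2 H2]].
  exists (Rmin d1 d2). split; [now apply Rmin_glb_lt|]. intros s Hin Hst.
  specialize (H1 s Hin (Rlt_le_trans _ _ _ Hst (Rmin_l _ _))).
  specialize (H2 s Hin (Rlt_le_trans _ _ _ Hst (Rmin_r _ _))).
  replace (_ - _) with ((f s - f t - lf * (s - t)) + e * (g s - g t - lg * (s - t))) by ring.
  eapply Rle_trans; [apply Rabs_triang|]. rewrite Rabs_mult.
  replace eps with (eps / (1 + Rabs e) + Rabs e * (eps / (1 + Rabs e))) at 1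
    by (field; lra).
  rewrite Rmult_plus_distr_r. apply Rplus_le_compat; [easy|].
  rewrite Rmult_assoc. apply Rmult_le_compat_l; [apply Rabs_pos|easy].
Qed.

(** [lim] is specified only for Cauchy proper filters. Properness holds because [a < b] leaves
    points of [[a, b]] arbitrarily near [t], and convergence to [l] makes the filter Cauchy. *)
Lemma deriv_in_unique (a b : R) (f : R -> R) (t l : R) : a < b -> a <= t <= b ->
  is_deriv_in a b f t l -> deriv_in a b f t = l.
Proof.
  intros Hab Ht H.
  set (F := within (fun s => a <= s <= b /\ s <> t) (locally t)).
  assert (PF : ProperFilter F).
  { split; [|apply within_filter, locally_filter]. intros P [d Hd].
    pose proof (cond_pos d).
    set (h := Rmin (d / 2) ((b - a) / 2)).
    assert (0 < h) by (apply Rmin_glb_lt; lra).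
    assert (h <= d / 2) by apply Rmin_l. assert (h <= (b - a) / 2) by apply Rmin_r.
    exists (if Rle_dec t ((a + b) / 2) then t + h else t - h).
    apply Hd; destruct Rle_dec; try (split; lra).
    - apply Rabs_def1; unfold minus, plus, opp; simpl; lra.
    - apply Rabs_def1; unfold minus, plus, opp; simpl; lra. }
  pose (G := filtermap (fun s => (f s - f t) / (s - t)) F).
  assert (PG : ProperFilter G) by (unfold G; apply filtermap_proper_filter, PF).
  assert (HG : forall eps : posreal, G (ball l eps)).
  { intros eps. apply (proj1 (filterlim_locally _ _) H eps). }
  unfold deriv_in. fold F. fold G.
  assert (HL : forall eps : posreal, G (ball (lim G) eps)).
  { apply complete_cauchy; [easy|]. intros eps. now exists l. }
  apply cond_eq. intros eps He.
  assert (He2 : 0 < eps / 2) by lra.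
  destruct (filter_ex _ (filter_and _ _ (HL (mkposreal _ He2)) (HG (mkposreal _ He2))))
    as [y [H1 H2]].
  apply Rabs_def2 in H1. apply Rabs_def2 in H2.
  unfold minus, plus, opp in H1, H2; simpl in H1, H2.
  apply Rabs_def1; simpl; lra.
Qed.

(** One-sided derivatives see only values on [[a, b]], so agreement there with a tower of ordinary
    derivatives propagates through all orders. *)
Lemma dern_tower (a b : R) (f : R -> R) (F : nat -> R -> R) (k : nat) : a < b ->
  (forall t, a <= t <= b -> f t = F O t) ->
  (forall j, (j < k)%nat -> forall t, is_derive (F j) t (F (S j) t)) ->
  forall j, (j <= k)%nat -> forall t, a <= t <= b -> dern a b j f t = F j t.
Proof.
  intros Hab H0 HF j. induction j; intros Hj t Ht; [now apply H0|].
  simpl. apply deriv_in_unique; [easy|easy|].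
  apply is_deriv_in_of_is_derive with (F j); [easy| |apply HF; lia].
  intros s Hs. apply IHj; [lia|easy].
Qed.

Lemma Ck_on_tower (a b : R) (f : R -> R) (F : nat -> R -> R) (k : nat) : a < b ->
  (forall t, a <= t <= b -> f t = F O t) ->
  (forall j, (j < k)%nat -> forall t, is_derive (F j) t (F (S j) t)) ->
  (forall j, (j <= k)%nat -> ctn (F j)) ->
  Ck_on k a b f.
Proof.
  intros Hab H0 HF HC. pose proof (dern_tower a b f F k Hab H0 HF) as E. split.
  - intros j Hj t Ht. rewrite (E (S j)) by (easy || lia).
    apply is_deriv_in_of_is_derive with (F j); [easy| |apply HF; lia].
    intros s Hs. apply E; [lia|easy].
  - intros j Hj. apply cont_on_of_ctn with (F j); [now apply HC|].
    intros t Ht. now apply E.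
Qed.

Lemma dern_lin (a b e : R) (f g : R -> R) (k : nat) : a < b ->
  Ck_on k a b f -> Ck_on k a b g ->
  forall j, (j <= k)%nat -> forall t, a <= t <= b ->
    dern a b j (fun t => f t + e * g t) t = dern a b j f t + e * dern a b j g t.
Proof.
  intros Hab [Hf _] [Hg _] j. induction j; intros Hj t Ht; [easy|].
  simpl. apply deriv_in_unique; [easy|easy|].
  assert (H := is_deriv_in_lin a b e _ _ t _ _ (Hf j ltac:(lia) t Ht) (Hg j ltac:(lia) t Ht)).
  (* The induction hypothesis equates the functions on [[a, b]] only, so it is applied to values
     inside the estimate. *)
  apply is_deriv_in_eps. intros eps He.
  destruct (proj1 (is_deriv_in_eps _ _ _ _ _) H eps He) as [d [Hd Hs]].
  exists d. split; [easy|]. intros s Hin Hst. rewrite !IHj by (easy || lia).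
  now apply Hs.
Qed.

(** * Fractional operators as kernel integrals of continuous functions *)

Lemma mord_between (alpha : R) (k : nat) : INR k < alpha < INR k + 1 -> mord alpha = S k.
Proof.
  intros H. unfold mord. rewrite <- (tech_up alpha (Z.of_nat (S k))).
  - apply Nat2Z.id.
  - rewrite <- INR_IZR_INZ, S_INR. lra.
  - rewrite <- INR_IZR_INZ, S_INR. lra.
Qed.

Lemma caputoL_kernel (a b alpha : R) (f W : R -> R) (t : R) :
  a < t <= b -> 0 < INR (mord alpha) - alpha -> ctn W ->
  (forall s, a <= s <= b -> dern a b (mord alpha) f s = W s) ->
  let beta := INR (mord alpha) - alpha in
  caputoL a b alpha f t =
    / Gamma beta * (/ beta * RInt (fun s => W (t - pw (/ beta) s)) 0 (pw beta (t - a))).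
Proof.
  intros Ht Hb HW E beta. unfold caputoL. destruct Rle_dec; [lra|]. f_equal.
  apply (is_RInt_gen_unique (V := R_CompleteNormedModule)).
  apply is_RInt_gen_ext with (fun tau => Rpower (t - tau) (beta - 1) * W tau).
  - apply at_right_left_within; [easy|]. intros s Hs. unfold beta. rewrite E; [easy|lra].
  - now apply is_RInt_gen_kernel_l.
Qed.

Lemma caputoL_lker (a b alpha : R) (f W : R -> R) (t : R) :
  a <= t <= b -> 0 < INR (mord alpha) - alpha -> ctn W ->
  (forall s, s <= a -> W s = 0) ->
  (forall s, a <= s <= b -> dern a b (mord alpha) f s = W s) ->
  let beta := INR (mord alpha) - alpha in
  caputoL a b alpha f t = / Gamma beta * / beta * lker beta a b W t.
Proof.
  intros Ht Hb HW H0 E beta.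
  rewrite lker_eq by easy.
  destruct (Req_dec t a) as [->|Hn].
  (* At [t = a] the default value 0 of [caputoL] matches an integral over a degenerate interval. *)
  - unfold caputoL. destruct Rle_dec; [|lra].
    rewrite Rminus_diag, (pw_neg beta 0), RInt_point by lra.
    unfold zero; simpl. ring.
  - rewrite (caputoL_kernel a b alpha f W) by (easy || lra). fold beta. ring.
Qed.

(** Linearity is checked after the substitution, on integrals of continuous functions. [lker] is out
    of reach because the derivative of order [m] need not vanish at [a], hence the clamped [W] and
    [caputoL_kernel]. *)
Lemma caputoL_lin (a b alpha e : R) (f g : R -> R) (k : nat) (t : R) :
  a < b -> a <= t <= b -> 0 < INR (mord alpha) - alpha -> (mord alpha <= k)%nat ->
  Ck_on k a b f -> Ck_on k a b g ->
  caputoL a b alpha (fun t => f t + e * g t) t = caputoL a b alpha f t + e * caputoL a b alpha g t.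
Proof.
  intros Hab Ht Hb Hk Hf Hg.
  destruct (Req_dec t a) as [->|Hn].
  { unfold caputoL. destruct Rle_dec; lra. }
  set (m := mord alpha).
  set (W := fun h t => dern a b m h (clamp a b t)).
  assert (HW : forall h s, a <= s <= b -> dern a b m h s = W h s).
  { intros h s Hs. unfold W. now rewrite clamp_id. }
  assert (Hc : forall h, Ck_on k a b h -> ctn (W h)).
  { intros h [_ Hh]. apply cont_on_clamp; [lra|]. now apply Hh. }
  assert (Ht' : a < t <= b) by lra.
  rewrite (caputoL_kernel a b alpha f (W f)) by auto.
  rewrite (caputoL_kernel a b alpha g (W g)) by auto.
  rewrite (caputoL_kernel a b alpha _ (fun t => W f t + e * W g t)); auto with ctn.
  2:{ intros s Hs. fold m. rewrite (dern_lin a b e f g k) by auto. now rewrite !HW. }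
  set (beta := INR (mord alpha) - alpha) in *.
  assert (Hr : forall h, Ck_on k a b h -> ctn (fun s => W h (t - pw (/ beta) s))).
  { intros h Hh. apply (ctn_comp (fun s => t - pw (/ beta) s) (W h)); [|auto].
    apply ctn_minus; [auto with ctn|]. apply pw_ctn. now apply Rinv_0_lt_compat. }
  rewrite (RInt_ctn_plus (fun s => W f (t - pw (/ beta) s))
             (fun s => e * W g (t - pw (/ beta) s))) by auto with ctn.
  rewrite RInt_ctn_scal by auto. ring.
Qed.

Lemma rl_int_right_rker (a b beta : R) (g G : R -> R) (t : R) :
  a <= t <= b -> 0 < beta -> ctn G -> (forall s, b <= s -> G s = G b) ->
  (forall s, a <= s <= b -> g s = G s) ->
  rl_int_right b beta g t = / Gamma beta * / beta * rker beta a b G t.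
Proof.
  intros Ht Hb HG H0 E. rewrite rker_eq by easy. unfold rl_int_right.
  destruct Rle_dec.
  - assert (t = b) as -> by lra.
    rewrite Rminus_diag, (pw_neg beta 0), RInt_point by lra.
    unfold zero; simpl. ring.
  - rewrite Rmult_assoc. f_equal.
    apply (is_RInt_gen_unique (V := R_CompleteNormedModule)).
    apply is_RInt_gen_ext with (fun tau => Rpower (tau - t) (beta - 1) * G tau).
    + apply at_right_left_within; [lra|]. intros s Hs. rewrite E; [easy|lra].
    + apply is_RInt_gen_kernel_r; [easy|lra|easy].
Qed.

Lemma Rpow_opp_1_sq (k : nat) : (-1) ^ k * (-1) ^ k = 1.
Proof. rewrite <- Rpow_mult_distr. replace (-1 * -1) with 1 by ring. apply pow1. Qed.

(** * From the weak form to the Euler-Lagrange equation *)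

(** Of the [m + p] integrations in the test function, [m] are moved onto [A] and [p] stay with [u].
    Both terms then pair with [iint a u p], and the fundamental lemma with depth [p] applies. *)
Lemma weak_form_kernel (a b alpha c : R) (m p : nat) (A G : R -> R) :
  let beta := INR m - alpha in
  a < b -> 0 < beta -> ctn A -> ctn G -> (forall s, b <= s -> G s = G b) ->
  (forall u, ctn u -> (forall s, s <= a -> u s = 0) ->
     RInt (fun t => A t * iint a u (m + p) t
                    + G t * (c * lker beta a b (iint a u p) t)) a b = 0) ->
  forall t, a <= t <= b -> c * rker beta a b G t = - bint b A m t.
Proof.
  intros beta Hab Hb HA HG HG0 H t Ht.
  assert (HQ : ctn (fun t => bint b A m t + c * rker beta a b G t)).
  { apply ctn_plus; [now apply bint_ctn|]. apply ctn_mult; [auto with ctn|].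
    now apply rker_ctn. }
  enough (E : bint b A m t + c * rker beta a b G t = 0) by lra.
  revert t Ht.
  apply (fundamental_lemma_iint a b _ p Hab HQ). intros u Hu Hu0.
  rewrite <- (H u Hu Hu0).
  assert (Hp : ctn (iint a u p)) by now apply iint_ctn.
  assert (Hp0 := iint_vanish a u p Hu Hu0).
  assert (Hl := lker_ctn beta a b (iint a u p) Hb Hp).
  assert (Hr := rker_ctn beta a b G Hb HG).
  assert (Hmp : ctn (iint a u (m + p))) by now apply iint_ctn.
  assert (Hbm := bint_ctn b A m HA).
  rewrite RInt_ctn_plus by auto with ctn.
  rewrite (RInt_ext_all (fun t => G t * (c * lker beta a b (iint a u p) t))
             (fun t => c * (G t * lker beta a b (iint a u p) t))) by (intros; ring).
  rewrite RInt_ctn_scal by auto with ctn. rewrite frac_int_by_parts by auto.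
  rewrite iint_add, (iint_bint_dual a b (iint a u p) A m) by easy.
  rewrite <- RInt_ctn_scal, <- RInt_ctn_plus by auto with ctn.
  apply RInt_ext_all. intros t. ring.
Qed.

Lemma dern_of_bint (a b : R) (A g : R -> R) (m : nat) : a < b -> ctn A ->
  (forall t, a <= t <= b -> g t = - bint b A m t) ->
  forall j, (j <= m)%nat -> forall t, a <= t <= b ->
    dern a b j g t = - (-1) ^ j * bint b A (m - j) t.
Proof.
  intros Hab HA E.
  apply (dern_tower a b g (fun j t => - (-1) ^ j * bint b A (m - j) t) m Hab).
  - intros t Ht. rewrite E, Nat.sub_0_r by easy. simpl. ring.
  - intros j Hj t.
    replace (- (-1) ^ S j * bint b A (m - S j) t)
      with (- (-1) ^ j * - bint b A (m - S j) t) by (simpl; ring).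
    apply (is_derive_scal (bint b A (m - j))).
    replace (m - j)%nat with (S (m - S j)) by lia. now apply bint_is_derive.
Qed.

Lemma Euler_Lagrange_of_weak_form (a b alpha : R) (k p : nat) (A G g : R -> R) :
  a < b -> INR k < alpha < INR k + 1 -> ctn A -> ctn G ->
  (forall s, b <= s -> G s = G b) -> (forall t, a <= t <= b -> g t = G t) ->
  let beta := INR (S k) - alpha in
  (forall u, ctn u -> (forall s, s <= a -> u s = 0) ->
     RInt (fun t => A t * iint a u (S k + p) t
        + G t * (/ Gamma beta * / beta * lker beta a b (iint a u p) t)) a b = 0) ->
  (forall t, a <= t <= b -> A t + rl_right a b alpha g t = 0) /\
  (forall j, (j <= k)%nat -> rl_right_op a b (alpha + INR j - (INR k + 1)) g b = 0).
Proof.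
  intros Hab Hal HA HG HG0 Eg beta H.
  assert (Hb : 0 < beta) by (unfold beta; rewrite S_INR; lra).
  assert (HK := weak_form_kernel a b alpha (/ Gamma beta * / beta) (S k) p A G
                  Hab Hb HA HG HG0 H).
  assert (HI : forall t, a <= t <= b -> rl_int_right b beta g t = - bint b A (S k) t).
  { intros t Ht. rewrite (rl_int_right_rker a b beta g G) by easy. now apply HK. }
  assert (HD := dern_of_bint a b A _ (S k) Hab HA HI).
  split.
  - intros t Ht. unfold rl_right. rewrite (mord_between alpha k Hal). fold beta.
    rewrite HD by easy. rewrite Nat.sub_diag. simpl (bint b A 0 t).
    (* One sign comes from the right Riemann-Liouville derivative, the other from differentiating
       [bint]. *)
    replace (A t + _) with (A t - ((-1) ^ S k * (-1) ^ S k) * A t) by ring.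
    rewrite Rpow_opp_1_sq. ring.
  - intros j Hj. unfold rl_right_op. destruct j as [|j].
    (* For [j = 0] the order is negative, and the fractional integral over the degenerate interval
       at [b] is 0. *)
    + destruct Rlt_dec as [Hlt|Hlt]; [|simpl in Hlt; lra].
      unfold rl_int_right. destruct Rle_dec; [easy|lra].
    (* With [S j] in place of [j] the order lies in [(j, j + 1)]. It is thus a derivative of integer
       order [S j] of the same fractional integral of order [beta], and the remaining depth of
       [bint] is still positive because [S j <= k]. *)
    + assert (Hpos := pos_INR j). rewrite S_INR.
      destruct Rlt_dec as [Hlt|Hlt]; [lra|].
      unfold rl_right. rewrite (mord_between _ j) by lra.
      replace (INR (S j) - (alpha + (INR j + 1) - (INR k + 1))) with beta
        by (unfold beta; rewrite !S_INR; ring).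
      rewrite HD by (lia || lra).
      replace (S k - S j)%nat with (S (k - S j)) by lia.
      rewrite bint_at_end. ring.
Qed.

(** * Linearization of the state equation *)

Lemma ctn_bounded (a b : R) (f : R -> R) : a <= b -> ctn f ->
  exists M, 0 < M /\ forall t, a <= t <= b -> Rabs (f t) <= M.
Proof.
  intros Hab Hf.
  assert (Hc : forall t, a <= t <= b -> continuity_pt (fun t => Rabs (f t)) t).
  { intros t _. apply continuity_pt_filterlim, (continuous_comp f Rabs); [apply Hf|].
    apply continuous_Rabs. }
  destruct (continuity_ab_maj _ a b Hab Hc) as [x [Hx _]].
  exists (Rabs (f x) + 1). split; [pose proof (Rabs_pos (f x)); lra|].
  intros t Ht. specialize (Hx t Ht). simpl in Hx. lra.
Qed.

Lemma MVT_bound (a b c : R) (W dW : R -> R) : a <= b -> ctn W ->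
  (forall t, a < t < b -> is_derive W t (dW t)) ->
  (forall t, a < t < b -> Rabs (dW t) <= c) -> 0 <= c ->
  Rabs (W b - W a) <= c * (b - a).
Proof.
  intros Hab HW Hd Hc Hc0.
  destruct (Rle_lt_or_eq_dec a b Hab) as [Hlt|<-].
  2:{ rewrite !Rminus_diag, Rabs_R0. lra. }
  destruct (MVT W (fun t => t) a b (fun t Ht => ex_derive_Reals_0 W t (ex_intro _ (dW t) (Hd t Ht)))
              (fun t _ => derivable_pt_id t) Hlt (fun t _ => ctn_pt W HW t)
              (fun t _ => derivable_continuous_pt _ _ (derivable_pt_id t))) as [t [Ht E]].
  rewrite derive_pt_id in E.
  rewrite (derive_pt_eq_0 _ _ _ _ (proj1 (is_derive_Reals _ _ _) (Hd t Ht))) in E.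
  replace (W b - W a) with (dW t * (b - a)) by lra.
  rewrite Rabs_mult, (Rabs_pos_eq (b - a)) by lra.
  apply Rmult_le_compat_r; [lra|now apply Hc].
Qed.

(* Continuity argument: a derivative bound that holds only while [|W| <= M]
   keeps [|W|] below [M] up to [b]. *)
Lemma bootstrap_bound (a b c M : R) (W dW : R -> R) : a < b -> ctn W -> W a = 0 ->
  0 <= c -> c * (b - a) < M ->
  (forall t, a < t < b -> is_derive W t (dW t)) ->
  (forall t, a < t < b -> Rabs (W t) <= M -> Rabs (dW t) <= c) ->
  Rabs (W b) <= c * (b - a).
Proof.
  intros Hab HW Ha Hc HcM Hd Hb.
  set (S := fun t => a <= t <= b /\ forall s, a <= s <= t -> Rabs (W s) <= M).
  assert (HM : 0 < M) by nra.
  assert (HSa : S a).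
  { split; [lra|]. intros s Hs. replace s with a by lra. rewrite Ha, Rabs_R0. lra. }
  destruct (completeness S) as [T [HT1 HT2]].
  { exists b. intros t [Ht _]. lra. }
  { now exists a. }
  assert (HTa : a <= T) by now apply HT1.
  assert (HTb : T <= b) by (apply HT2; intros t [Ht _]; lra).
  assert (Hbelow : forall s, a <= s < T -> Rabs (W s) <= M).
  { intros s Hs. destruct (classic (exists t, S t /\ s < t)) as [[t [[Ht1 Ht2] Hst]]|Hn].
    - apply Ht2. lra.
    - exfalso. assert (T <= s); [|lra]. apply HT2. intros t Ht.
      destruct (Rle_dec t s); [easy|]. exfalso. apply Hn. exists t. split; [easy|lra]. }
  assert (HWT : Rabs (W T) <= c * (T - a)).
  { rewrite <- (Rminus_0_r (W T)), <- Ha.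
    apply MVT_bound with dW; auto; intros t Ht.
    - apply Hd. lra.
    - apply Hb; [lra|]. apply Hbelow. lra. }
  (* At the supremum [T] the derivative bound has improved [M] to the strictly smaller
     [c * (T - a)], so the bound [M] survives a little beyond [T]. *)
  destruct (Req_dec T b) as [->|HTn]; [easy|exfalso].
  assert (HWT' : Rabs (W T) < M) by nra.
  destruct (ctn_eps_inv W HW T (M - Rabs (W T)) ltac:(lra)) as [d [Hd0 Hds]].
  set (t := T + Rmin (d / 2) (b - T)).
  assert (0 < Rmin (d / 2) (b - T)) by (apply Rmin_glb_lt; lra).
  assert (Rmin (d / 2) (b - T) <= d / 2) by apply Rmin_l.
  assert (Rmin (d / 2) (b - T) <= b - T) by apply Rmin_r.
  assert (S t).
  { split; [unfold t; lra|]. intros s Hs. destruct (Rlt_dec s T); [apply Hbelow; lra|].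
    assert (Rabs (s - T) < d) by (unfold t in Hs; apply Rabs_def1; lra).
    specialize (Hds s H2). pose proof (Rabs_triang_inv (W s) (W T)). lra. }
  specialize (HT1 t H2). unfold t in HT1. lra.
Qed.

Lemma Rabs_le_of_forall_eps (x K : R) : 0 < K -> (forall eps, 0 < eps -> Rabs x <= K * eps) -> x = 0.
Proof.
  intros HK H. destruct (Req_dec x 0) as [|Hn]; [easy|exfalso].
  pose proof (Rabs_pos_lt x Hn) as Hp.
  specialize (H (Rabs x / (2 * K))).
  assert (0 < Rabs x / (2 * K)) by (apply Rdiv_lt_0_compat; lra).
  specialize (H H0). replace (K * (Rabs x / (2 * K))) with (Rabs x / 2) in H by (field; lra).
  lra.
Qed.

(** [F] takes increments from the reference trajectory. The difference [om] of two states satisfies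
    the linearized equation up to a remainder [o(e)], with integrating factor [lm]; hence
    [lm * om - e * V] is [o(e)] at [b]. Stationarity makes [om b] itself [o(e)], and division by [e]
    leaves [V b = 0]. *)
Lemma linearized_state_equation (a b d0 : R) (F : R -> R -> R -> R -> R)
  (A B C h D y0 : R -> R) (y : R -> R -> R) :
  a < b -> ctn A -> ctn B -> ctn C -> ctn h -> ctn D ->
  (forall eps, 0 < eps -> exists rho, 0 < rho /\ forall t p q w, a <= t <= b ->
     Rabs p < rho -> Rabs q < rho -> Rabs w < rho ->
     Rabs (F t p q w - F t 0 0 0 - (A t * p + B t * q + C t * w))
       <= eps * (Rabs p + Rabs q + Rabs w)) ->
  (forall t, a <= t <= b -> is_deriv_in a b y0 t (F t 0 0 0)) ->
  0 < d0 ->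
  (forall e, Rabs e < d0 -> y e a = y0 a /\ forall t, a <= t <= b ->
     is_deriv_in a b (y e) t (F t (e * h t) (e * D t) (y e t - y0 t))) ->
  y 0 b = y0 b ->
  is_derive (fun e => y e b) 0 0 ->
  RInt (fun t => exp (- RInt C a t) * (A t * h t + B t * D t)) a b = 0.
Proof.
  intros Hab HA HB HC Hh HD HF Hy0 Hd0 Hy Hyb Hder.
  set (lm := fun t => exp (- RInt C a t)).
  assert (Hlm : ctn lm) by (unfold lm; auto 6 with ctn).
  assert (Hlmpos : forall t, 0 < lm t) by (intros; apply exp_pos).
  assert (Hlmd : forall t, is_derive lm t (- C t * lm t)).
  { intros t. apply (is_derive_comp exp (fun t => - RInt C a t)); [apply is_derive_exp|].
    apply (is_derive_opp (fun t => RInt C a t)). now apply ctn_is_derive_RInt. }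
  set (k := fun t => lm t * (A t * h t + B t * D t)).
  assert (Hk : ctn k) by (unfold k; auto with ctn).
  set (V := fun t => RInt k a t).
  assert (HV : ctn V) by (unfold V; auto with ctn).
  change (V b = 0).
  destruct (ctn_bounded a b lm ltac:(lra) Hlm) as [L1 [HL1 HL1b]].
  destruct (ctn_bounded a b (fun t => exp (RInt C a t)) ltac:(lra)) as [L2 [HL2 HL2b]];
    [auto with ctn|].
  destruct (ctn_bounded a b V ltac:(lra) HV) as [V0 [HV0 HV0b]].
  destruct (ctn_bounded a b h ltac:(lra) Hh) as [h0 [Hh0 Hh0b]].
  destruct (ctn_bounded a b D ltac:(lra) HD) as [D0 [HD0 HD0b]].
  (* While [|W| <= e], solving for the state difference gives [|om| <= c1 * e]. Then [c2 * eps * e]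
     bounds the derivative of [W]. *)
  set (c1 := L2 * (1 + V0)). assert (Hc1 : 0 < c1) by (unfold c1; nra).
  set (c2 := L1 * (h0 + D0 + c1)). assert (Hc2 : 0 < c2) by (unfold c2; nra).
  apply Rabs_le_of_forall_eps with (c2 * (b - a) + L1); [nra|]. intros eps0 Heps0.
  (* The second bound on [eps] gives [c2 * eps * e * (b - a) < e], which the bootstrap needs with
     [M = e]. *)
  set (eps := Rmin eps0 (/ (2 * c2 * (b - a)))).
  assert (Hc2b : 0 < 2 * c2 * (b - a)) by (repeat apply Rmult_lt_0_compat; lra).
  assert (Heps : 0 < eps) by (apply Rmin_glb_lt; [easy|now apply Rinv_0_lt_compat]).
  assert (Heps1 : eps <= eps0) by apply Rmin_l.
  assert (Heps2 : c2 * eps * (b - a) < 1).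
  { assert (E : eps <= / (2 * c2 * (b - a))) by apply Rmin_r.
    apply Rmult_le_compat_l with (r := 2 * c2 * (b - a)) in E; [|lra].
    rewrite Rinv_r in E by lra. nra. }
  destruct (HF eps Heps) as [rho [Hrho HR]].
  apply is_derive_Reals in Hder. destruct (Hder eps Heps) as [d1 Hd1].
  (* [e * K < rho] puts all three increments inside the radius of the expansion. *)
  set (K := 1 + h0 + D0 + c1). assert (HK : 0 < K) by (unfold K; lra).
  set (e := Rmin (Rmin d0 d1) (rho / K) / 2).
  assert (Hmin : 0 < Rmin (Rmin d0 d1) (rho / K)).
  { repeat apply Rmin_glb_lt; [easy|apply cond_pos|now apply Rdiv_lt_0_compat]. }
  assert (He : 0 < e) by (unfold e; lra).
  assert (He0 : e < d0).
  { unfold e. pose proof (Rmin_l (Rmin d0 d1) (rho / K)). pose proof (Rmin_l d0 d1). lra. }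
  assert (He1 : e < d1).
  { unfold e. pose proof (Rmin_l (Rmin d0 d1) (rho / K)). pose proof (Rmin_r d0 d1). lra. }
  assert (HeK : e * K < rho).
  { assert (e < rho / K) by (unfold e; pose proof (Rmin_r (Rmin d0 d1) (rho / K)); lra).
    apply Rmult_lt_compat_r with (r := K) in H; [|easy].
    replace (rho / K * K) with rho in H by (field; lra). easy. }
  assert (Hae : Rabs e = e) by (apply Rabs_pos_eq; lra).
  destruct (Hy e ltac:(lra)) as [Hya Hyd].
  set (om := fun t => y e (clamp a b t) - y0 (clamp a b t)).
  assert (Hom : ctn om).
  { apply ctn_minus; (apply cont_on_clamp; [lra|]); eapply is_deriv_in_cont; [apply Hyd|apply Hy0]. }
  set (dom := fun t => F t (e * h t) (e * D t) (om t) - F t 0 0 0).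
  assert (Homd : forall t, a < t < b -> is_derive om t (dom t)).
  { intros t Ht. unfold om, dom.
    apply (is_derive_minus (fun t => y e (clamp a b t)) (fun t => y0 (clamp a b t)));
      apply is_derive_clamp_of_is_deriv_in; try easy.
    - unfold om. rewrite clamp_id by lra. apply Hyd. lra.
    - apply Hy0. lra. }
  (* [lm] absorbs the term in [C], and [e * V] the first-order source, so [dW] is [lm] times the
     Taylor remainder alone. *)
  set (W := fun t => lm t * om t - e * V t).
  set (dW := fun t => (- C t * lm t * om t + lm t * dom t) - e * k t).
  assert (HW : Rabs (W b) <= c2 * eps * e * (b - a)).
  { apply bootstrap_bound with (M := e) (dW := dW); try easy.
    - unfold W. auto with ctn.
    - unfold W, V, om. rewrite clamp_id, Hya, RInt_point by lra. unfold zero; simpl. ring.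
    - repeat apply Rmult_le_pos; lra.
    - nra.
    - intros t Ht. apply (is_derive_minus (fun t => lm t * om t) (fun t => e * V t)).
      + apply (is_derive_mult lm om); [apply Hlmd|now apply Homd|intros; apply Rmult_comm].
      + apply (is_derive_scal V). now apply ctn_is_derive_RInt.
    - intros t Ht HWt.
      assert (Ht' : a <= t <= b) by lra.
      assert (Homb : Rabs (om t) <= c1 * e).
      { replace (om t) with (exp (RInt C a t) * (W t + e * V t)).
        2:{ unfold W, lm. rewrite exp_Ropp. field. apply Rgt_not_eq, exp_pos. }
        rewrite Rabs_mult. unfold c1. rewrite Rmult_assoc.
        apply Rmult_le_compat; try apply Rabs_pos; [now apply HL2b|].
        eapply Rle_trans; [apply Rabs_triang|]. rewrite Rabs_mult, Hae.
        specialize (HV0b t Ht'). nra. }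
      assert (Hhb : Rabs (e * h t) <= h0 * e).
      { rewrite Rabs_mult, Hae. specialize (Hh0b t Ht'). nra. }
      assert (HDb : Rabs (e * D t) <= D0 * e).
      { rewrite Rabs_mult, Hae. specialize (HD0b t Ht'). nra. }
      replace (dW t) with (lm t * (F t (e * h t) (e * D t) (om t) - F t 0 0 0
         - (A t * (e * h t) + B t * (e * D t) + C t * om t))) by (unfold dW, dom, k; ring).
      rewrite Rabs_mult.
      replace (c2 * eps * e) with (L1 * (eps * (h0 * e + D0 * e + c1 * e)))
        by (unfold c2; ring).
      apply Rmult_le_compat; try apply Rabs_pos; [now apply HL1b|].
      eapply Rle_trans; [apply HR; try easy; unfold K in HeK; nra|].
      apply Rmult_le_compat_l; lra. }
  assert (Hyeb : Rabs (om b) <= eps * e).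
  { specialize (Hd1 e ltac:(lra) ltac:(lra)). rewrite Rplus_0_l, Hyb, Rminus_0_r in Hd1.
    unfold om. rewrite clamp_id by lra.
    replace (y e b - y0 b) with ((y e b - y0 b) / e * e) by (field; lra).
    rewrite Rabs_mult, Hae. apply Rmult_le_compat_r; lra. }
  assert (HeV : e * Rabs (V b) <= c2 * eps * e * (b - a) + L1 * (eps * e)).
  { rewrite <- Hae at 1. rewrite <- Rabs_mult.
    replace (e * V b) with (- W b + lm b * om b) by (unfold W; ring).
    eapply Rle_trans; [apply Rabs_triang|]. rewrite Rabs_Ropp, Rabs_mult.
    apply Rplus_le_compat; [easy|].
    apply Rmult_le_compat; try apply Rabs_pos; [apply HL1b; lra|easy]. }
  apply Rle_trans with ((c2 * (b - a) + L1) * eps).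
  - apply Rmult_le_reg_l with e; [easy|]. lra.
  - apply Rmult_le_compat_l; [nra|easy].
Qed.

(** * First-order expansion of the Lagrangian along a trajectory *)

Lemma ival_inj (n : nat) (i j : idx n) : ival i = ival j -> i = j.
Proof.
  destruct i as [i Hi], j as [j Hj]. unfold ival; simpl. intros ->.
  f_equal. apply le_unique.
Qed.

Lemma upd_same (n : nat) (x : idx n -> R) (i : idx n) (y : R) : upd x i y i = y.
Proof. unfold upd. now rewrite Nat.eqb_refl. Qed.

Lemma upd_upd (n : nat) (x : idx n -> R) (i : idx n) (y y' : R) :
  upd (upd x i y) i y' = upd x i y'.
Proof.
  apply functional_extensionality. intros k. unfold upd. now destruct Nat.eqb.
Qed.

Lemma upd_id (n : nat) (x : idx n -> R) (i : idx n) : upd x i (x i) = x.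
Proof.
  apply functional_extensionality. intros k. unfold upd.
  destruct (Nat.eqb_spec (ival k) (ival i)) as [E|]; [|easy].
  now rewrite (ival_inj n k i E).
Qed.

Lemma Rabs_upd (n : nat) (x : idx n -> R) (i k : idx n) (p : R) :
  Rabs (upd x i (x i + p) k - x k) <= Rabs p.
Proof.
  unfold upd. destruct (Nat.eqb_spec (ival k) (ival i)) as [E|].
  - rewrite (ival_inj n k i E). right. f_equal. ring.
  - rewrite Rminus_diag, Rabs_R0. apply Rabs_pos.
Qed.

(** A minimum of finitely many radii, taken by induction on a cutoff for the index. *)
Lemma idx_uniform (n : nat) (P : idx n -> R -> Prop) :
  (forall k d d', P k d -> d' <= d -> P k d') ->
  (forall k, exists d, 0 < d /\ P k d) -> exists d, 0 < d /\ forall k, P k d.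
Proof.
  intros Hm HP.
  assert (H : forall m, exists d, 0 < d /\ forall k : idx n, (ival k < m)%nat -> P k d).
  { induction m as [|m [d [Hd IH]]].
    - exists 1. split; [lra|]. intros k Hk. lia.
    - destruct (lt_dec m n) as [Hmn|Hmn].
      + set (k0 := exist _ m Hmn : idx n). destruct (HP k0) as [d' [Hd' HP']].
        exists (Rmin d d'). split; [now apply Rmin_glb_lt|]. intros k Hk.
        destruct (Nat.eq_dec (ival k) m) as [E|Hn].
        * assert (k = k0) as -> by now apply ival_inj. apply Hm with d'; [easy|apply Rmin_r].
        * apply Hm with d; [apply IH; lia|apply Rmin_l].
      + exists d. split; [easy|]. intros k Hk. apply IH.
        destruct k as [k Hkn]. unfold ival in *; simpl in *. lia. }
  destruct (H n) as [d [Hd Hk]]. exists d. split; [easy|]. intros k. apply Hk.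
  apply (proj2_sig k).
Qed.

(** Compactness through a gauge: each centre gets one number serving as both radii, and finitely
    many centres suffice. The gauge must be a function on the whole line, so it is obtained by
    choice, with a dummy value outside [[a, b]]. *)
Lemma compact_uniform (a b : R) (P : R -> R -> Prop) :
  (forall t r r', P t r -> r' <= r -> P t r') ->
  (forall t0, a <= t0 <= b -> exists d r, 0 < d /\ 0 < r /\
     forall t, a <= t <= b -> Rabs (t - t0) < d -> P t r) ->
  exists r, 0 < r /\ forall t, a <= t <= b -> P t r.
Proof.
  intros Hm HP.
  assert (HP' : forall t0, exists d : posreal, a <= t0 <= b ->
            forall t, a <= t <= b -> Rabs (t - t0) < d -> P t d).
  { intros t0. destruct (classic (a <= t0 <= b)) as [Ht0|Ht0].
    - destruct (HP t0 Ht0) as [d [r [Hd [Hr H]]]].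
      assert (Hdr : 0 < Rmin d r) by now apply Rmin_glb_lt.
      exists (mkposreal _ Hdr). intros _ t Ht Htd. simpl in *.
      apply Hm with r; [|apply Rmin_r]. apply H; [easy|].
      eapply Rlt_le_trans; [apply Htd|apply Rmin_l].
    - exists (mkposreal 1 Rlt_0_1). intros; contradiction. }
  set (dl := fun t => proj1_sig (constructive_indefinite_description _ (HP' t))).
  assert (Hdl : forall t0, a <= t0 <= b ->
            forall t, a <= t <= b -> Rabs (t - t0) < dl t0 -> P t (dl t0)).
  { intros t0. unfold dl. now destruct constructive_indefinite_description. }
  destruct (compactness_value_1d a b dl) as [d Hd].
  exists d. split; [apply cond_pos|]. intros t Ht.
  destruct (NNPP _ (Hd t Ht)) as [s [Hs [Hts Hds]]].
  apply Hm with (dl s); [|easy]. now apply Hdl.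
Qed.

(** The radius [r] is measured from the trajectory at [t], not at [t0]. This serves both continuity
    along the trajectory and uniformity in a tube around it. *)
Lemma cont_dom_along (n : nat) (a b : R) (H : Lag n) (X V : R -> idx n -> R) (Z : R -> R)
  (t0 eps : R) : a <= t0 <= b -> 0 < eps ->
  cont_dom a b H -> (forall k, cont_on a b (fun t => X t k)) ->
  (forall k, cont_on a b (fun t => V t k)) -> cont_on a b Z ->
  exists d r, 0 < d /\ 0 < r /\ forall t, a <= t <= b -> Rabs (t - t0) < d ->
    forall x v z, (forall k, Rabs (x k - X t k) < r) -> (forall k, Rabs (v k - V t k) < r) ->
      Rabs (z - Z t) < r -> Rabs (H t x v z - H t0 (X t0) (V t0) (Z t0)) < eps.
Proof.
  intros Ht0 He HH HX HV HZ.
  destruct (HH t0 (X t0) (V t0) (Z t0) Ht0 eps He) as [d [Hd Hc]].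
  assert (HF : forall Y : R -> idx n -> R, (forall k, cont_on a b (fun t => Y t k)) ->
     exists d1, 0 < d1 /\ forall k t, a <= t <= b -> Rabs (t - t0) < d1 ->
       Rabs (Y t k - Y t0 k) < d / 2).
  { intros Y HY.
    apply (idx_uniform n (fun k d1 => forall t, a <= t <= b -> Rabs (t - t0) < d1 ->
       Rabs (Y t k - Y t0 k) < d / 2)).
    - intros k r r' Hk Hr t Ht Htr. apply Hk; [easy|lra].
    - intros k. apply (proj1 (cont_on_eps _ _ _) (HY k) t0 Ht0). lra. }
  destruct (HF X HX) as [d1 [Hd1 H1]]. destruct (HF V HV) as [d2 [Hd2 H2]].
  destruct (proj1 (cont_on_eps _ _ _) HZ t0 Ht0 (d / 2)) as [d3 [Hd3 H3]]; [lra|].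
  exists (Rmin d (Rmin d1 (Rmin d2 d3))), (d / 2).
  split; [repeat apply Rmin_glb_lt; easy|]. split; [lra|].
  intros t Ht Htd x v z Hx Hv Hz.
  assert (E0 := Rlt_le_trans _ _ _ Htd (Rmin_l _ _)).
  assert (E := Rlt_le_trans _ _ _ Htd (Rmin_r _ _)).
  assert (E1 := Rlt_le_trans _ _ _ E (Rmin_l _ _)).
  assert (E' := Rlt_le_trans _ _ _ E (Rmin_r _ _)).
  assert (E2 := Rlt_le_trans _ _ _ E' (Rmin_l _ _)).
  assert (E3 := Rlt_le_trans _ _ _ E' (Rmin_r _ _)).
  assert (Htri : forall p q r, Rabs (p - q) < d / 2 -> Rabs (q - r) < d / 2 -> Rabs (p - r) < d).
  { intros p q r Hp Hq. replace (p - r) with ((p - q) + (q - r)) by ring.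
    eapply Rle_lt_trans; [apply Rabs_triang|]. lra. }
  apply Hc; try easy.
  - intros k. apply Htri with (X t k); auto.
  - intros k. apply Htri with (V t k); auto.
  - apply Htri with (Z t); auto.
Qed.

Lemma cont_on_along (n : nat) (a b : R) (H : Lag n) (X V : R -> idx n -> R) (Z : R -> R) :
  cont_dom a b H -> (forall k, cont_on a b (fun t => X t k)) ->
  (forall k, cont_on a b (fun t => V t k)) -> cont_on a b Z ->
  cont_on a b (fun t => H t (X t) (V t) (Z t)).
Proof.
  intros HH HX HV HZ. apply cont_on_eps. intros t0 Ht0 eps He.
  destruct (cont_dom_along n a b H X V Z t0 eps Ht0 He HH HX HV HZ) as [d [r [Hd [Hr HB]]]].
  exists d. split; [easy|]. intros t Ht Htd.
  apply HB; try easy; intros; rewrite Rminus_diag, Rabs_R0; easy.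
Qed.

Lemma unif_along (n : nat) (a b : R) (H : Lag n) (X V : R -> idx n -> R) (Z : R -> R)
  (eps : R) : 0 < eps ->
  cont_dom a b H -> (forall k, cont_on a b (fun t => X t k)) ->
  (forall k, cont_on a b (fun t => V t k)) -> cont_on a b Z ->
  exists r, 0 < r /\ forall t, a <= t <= b ->
    forall x v z, (forall k, Rabs (x k - X t k) < r) -> (forall k, Rabs (v k - V t k) < r) ->
      Rabs (z - Z t) < r -> Rabs (H t x v z - H t (X t) (V t) (Z t)) < eps.
Proof.
  intros He HH HX HV HZ.
  apply (compact_uniform a b (fun t r => forall x v z, (forall k, Rabs (x k - X t k) < r) ->
     (forall k, Rabs (v k - V t k) < r) ->
      Rabs (z - Z t) < r -> Rabs (H t x v z - H t (X t) (V t) (Z t)) < eps)).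
  - intros t r r' HP Hr x v z Hx Hv Hz.
    apply HP; [intros k; specialize (Hx k)|intros k; specialize (Hv k)|]; lra.
  - intros t0 Ht0.
    destruct (cont_dom_along n a b H X V Z t0 (eps / 2) Ht0 ltac:(lra) HH HX HV HZ)
      as [d [r [Hd [Hr HB]]]].
    exists d, r. split; [easy|]. split; [easy|]. intros t Ht Htd x v z Hx Hv Hz.
    assert (E1 := HB t Ht Htd x v z Hx Hv Hz).
    assert (E2 : Rabs (H t (X t) (V t) (Z t) - H t0 (X t0) (V t0) (Z t0)) < eps / 2).
    { apply HB; try easy; intros; rewrite Rminus_diag, Rabs_R0; easy. }
    replace (H t x v z - H t (X t) (V t) (Z t)) with
      ((H t x v z - H t0 (X t0) (V t0) (Z t0))
       - (H t (X t) (V t) (Z t) - H t0 (X t0) (V t0) (Z t0))) by ring.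
    eapply Rle_lt_trans; [apply Rabs_triang|]. rewrite Rabs_Ropp. lra.
Qed.

Lemma increment_bound (f : R -> R) (c p l eps : R) :
  (forall y, ex_derive f y) ->
  (forall q, Rabs q <= Rabs p -> Rabs (Derive f (c + q) - l) <= eps) ->
  Rabs (f (c + p) - f c - l * p) <= eps * Rabs p.
Proof.
  intros Hf Hb.
  destruct (MVT_gen f c (c + p) (Derive f)) as [s [Hs E]].
  - intros y _. now apply Derive_correct.
  - intros y _. apply continuity_pt_filterlim, (ex_derive_continuous f), Hf.
  - replace (f (c + p) - f c - l * p) with ((Derive f s - l) * p) by (rewrite E; ring).
    rewrite Rabs_mult. apply Rmult_le_compat_r; [apply Rabs_pos|].
    replace s with (c + (s - c)) by ring. apply Hb. revert Hs.
    unfold Rmin, Rmax, Rabs. repeat destruct Rle_dec; repeat destruct Rcase_abs; lra.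
Qed.

(** The arguments are changed one at a time, and the mean value theorem is used for each. The
    intermediate points stay in a tube around the trajectory, where the partial derivatives are
    uniformly close to their values on it. *)
Lemma Lagrangian_expansion (n : nat) (a b : R) (L : Lag n) (i : idx n)
  (X V : R -> idx n -> R) (Z : R -> R) (eps : R) :
  C1_Lag a b L -> (forall k, cont_on a b (fun t => X t k)) ->
  (forall k, cont_on a b (fun t => V t k)) -> cont_on a b Z -> 0 < eps ->
  exists rho, 0 < rho /\ forall t p q w, a <= t <= b ->
    Rabs p < rho -> Rabs q < rho -> Rabs w < rho ->
    Rabs (L t (upd (X t) i (X t i + p)) (upd (V t) i (V t i + q)) (Z t + w)
          - L t (X t) (V t) (Z t)
          - (dLx L i t (X t) (V t) (Z t) * p + dLv L i t (X t) (V t) (Z t) * q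
             + dLz L t (X t) (V t) (Z t) * w))
    <= eps * (Rabs p + Rabs q + Rabs w).
Proof.
  intros [HL [_ [_ [Hx [Hv Hz]]]]] HX HV HZ He.
  destruct (unif_along n a b _ X V Z eps He (Hx i) HX HV HZ) as [r1 [Hr1 H1]].
  destruct (unif_along n a b _ X V Z eps He (Hv i) HX HV HZ) as [r2 [Hr2 H2]].
  destruct (unif_along n a b _ X V Z eps He Hz HX HV HZ) as [r3 [Hr3 H3]].
  exists (Rmin r1 (Rmin r2 r3)). split; [repeat apply Rmin_glb_lt; easy|].
  intros t p q w Ht Hp Hq Hw.
  assert (Hsplit : forall y, y < Rmin r1 (Rmin r2 r3) -> y < r1 /\ y < r2 /\ y < r3).
  { intros y Hy. pose proof (Rmin_l r1 (Rmin r2 r3)). pose proof (Rmin_r r1 (Rmin r2 r3)).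
    pose proof (Rmin_l r2 r3). pose proof (Rmin_r r2 r3). lra. }
  apply Hsplit in Hp, Hq, Hw.
  assert (Hself : forall (f : idx n -> R) r, 0 < r -> forall k, Rabs (f k - f k) < r).
  { intros f r Hr k. now rewrite Rminus_diag, Rabs_R0. }
  assert (Hupd : forall (f : idx n -> R) s s' r, Rabs s < r -> Rabs s' <= Rabs s ->
            forall k, Rabs (upd f i (f i + s') k - f k) < r).
  { intros f s s' r Hs Hs' k. eapply Rle_lt_trans; [apply Rabs_upd|]. lra. }
  assert (Hadd : forall y s r, Rabs s < r -> Rabs (y + s - y) < r).
  { intros y s r Hs. now replace (y + s - y) with s by ring. }
  set (x := X t) in *. set (v := V t) in *. set (z := Z t) in *.
  set (v' := upd v i (v i + q)). set (z' := z + w).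
  assert (E1 : Rabs (L t (upd x i (x i + p)) v' z' - L t x v' z' - dLx L i t x v z * p)
               <= eps * Rabs p).
  { pose proof (increment_bound (fun y => L t (upd x i y) v' z') (x i) p
      (dLx L i t x v z) eps) as E. cbv beta in E. rewrite upd_id in E. apply E; clear E.
    - intros y. destruct (HL t (upd x i y) v' z' Ht) as [_ [D _]]. specialize (D i).
      rewrite upd_same in D. eapply ex_derive_ext; [|exact D].
      intros s. simpl. now rewrite upd_upd.
    - intros s Hs. apply Rlt_le.
      (* The derivative at an intermediate point is the partial derivative at the updated argument,
         since a second update overrides the first. *)
      replace (Derive _ _) with (dLx L i t (upd x i (x i + s)) v' z').
      + apply H1; [easy|apply Hupd with p; tauto|apply Hupd with q; [tauto|lra]|apply Hadd; tauto].
      + unfold dLx. rewrite upd_same. apply Derive_ext. intros y. now rewrite upd_upd. }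
  assert (E2 : Rabs (L t x v' z' - L t x v z' - dLv L i t x v z * q) <= eps * Rabs q).
  { pose proof (increment_bound (fun y => L t x (upd v i y) z') (v i) q
      (dLv L i t x v z) eps) as E. cbv beta in E. rewrite upd_id in E. apply E; clear E.
    - intros y. destruct (HL t x (upd v i y) z' Ht) as [_ [_ [D _]]]. specialize (D i).
      rewrite upd_same in D. eapply ex_derive_ext; [|exact D].
      intros s. simpl. now rewrite upd_upd.
    - intros s Hs. apply Rlt_le.
      replace (Derive _ _) with (dLv L i t x (upd v i (v i + s)) z').
      + apply H2; [easy|now apply Hself|apply Hupd with q; tauto|apply Hadd; tauto].
      + unfold dLv. rewrite upd_same. apply Derive_ext. intros y. now rewrite upd_upd. }
  assert (E3 : Rabs (L t x v z' - L t x v z - dLz L t x v z * w) <= eps * Rabs w).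
  { apply (increment_bound (fun y => L t x v y)).
    - intros y. apply (HL t x v y Ht).
    - intros s Hs. apply Rlt_le. apply (H3 t Ht x v (z + s));
        [now apply Hself|now apply Hself|apply Hadd; lra]. }
  replace (_ - _ - _) with
    ((L t (upd x i (x i + p)) v' z' - L t x v' z' - dLx L i t x v z * p)
     + (L t x v' z' - L t x v z' - dLv L i t x v z * q)
     + (L t x v z' - L t x v z - dLz L t x v z * w)) by ring.
  eapply Rle_trans; [apply Rabs_triang|].
  rewrite !Rmult_plus_distr_l. apply Rplus_le_compat; [|easy].
  eapply Rle_trans; [apply Rabs_triang|]. now apply Rplus_le_compat.
Qed.

(** * Test functions *)

Lemma iint_tower (a : R) (u : R -> R) (N k : nat) : ctn u -> (k <= N)%nat ->
  forall j, (j < k)%nat -> forall t,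
    is_derive (iint a u (N - j)) t (iint a u (N - S j) t).
Proof.
  intros Hu Hk j Hj t. replace (N - j)%nat with (S (N - S j)) by lia.
  now apply iint_is_derive.
Qed.

Lemma dern_iint (a b : R) (u : R -> R) (N : nat) : a < b -> ctn u ->
  forall j, (j <= N)%nat -> forall t, a <= t <= b ->
    dern a b j (iint a u N) t = iint a u (N - j) t.
Proof.
  intros Hab Hu.
  apply (dern_tower a b _ (fun j => iint a u (N - j)) N Hab).
  - intros t _. now rewrite Nat.sub_0_r.
  - now apply iint_tower.
Qed.

Lemma caputoL_iint (a b alpha : R) (k p : nat) (u : R -> R) (t : R) :
  a < b -> INR k < alpha < INR k + 1 -> ctn u -> (forall s, s <= a -> u s = 0) ->
  a <= t <= b ->
  let beta := INR (S k) - alpha in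
  caputoL a b alpha (iint a u (S k + p)) t
  = / Gamma beta * / beta * lker beta a b (iint a u p) t.
Proof.
  intros Hab Hal Hu Hu0 Ht beta. unfold beta. rewrite <- (mord_between alpha k Hal).
  apply caputoL_lker; try easy.
  - rewrite (mord_between alpha k Hal), S_INR. lra.
  - now apply iint_ctn.
  - now apply iint_vanish.
  - intros s Hs. rewrite dern_iint by (easy || lia). f_equal. lia.
Qed.

Lemma iint_regular (a b alpha : R) (n k : nat) (u : R -> R) :
  a < b -> INR k < alpha < INR k + 1 -> (k < n)%nat -> ctn u -> (forall s, s <= a -> u s = 0) ->
  Ck_on n a b (iint a u (S n)) /\ Ck_on 1 a b (caputoL a b alpha (iint a u (S n))).
Proof.
  intros Hab Hal Hk Hu Hu0. split.
  - apply (Ck_on_tower a b _ (fun j => iint a u (S n - j)) n Hab).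
    + intros t _. now rewrite Nat.sub_0_r.
    + apply iint_tower; [easy|lia].
    + intros j _. now apply iint_ctn.
  (* The Caputo derivative consumes [S k] integrations; of the [S p] left, one is spent on the
     derivative in [t]. *)
  - set (p := (n - S k)%nat). replace (S n) with (S k + S p)%nat by (unfold p; lia).
    set (beta := INR (S k) - alpha).
    assert (Hb : 0 < beta) by (unfold beta; rewrite S_INR; lra).
    apply (Ck_on_tower a b _
      (fun j t => / Gamma beta * / beta * lker beta a b (iint a u (S p - j)) t) 1 Hab).
    + intros t Ht. now apply caputoL_iint.
    + intros j Hj t. assert (j = O) as -> by lia. apply is_derive_scal.
      apply lker_is_derive; [easy| |now apply iint_ctn].
      intros s. replace (S p - 1)%nat with p by lia. now apply iint_is_derive.
    + intros j _. apply ctn_mult; [auto with ctn|]. apply lker_ctn; [easy|now apply iint_ctn].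
Qed.

(** The other components are iterated integrals of 0, so regularity and vanishing at [a] need no
    separate case. *)
Definition component_variation {n} (a : R) (i : idx n) (u : R -> R) : idx n -> R -> R :=
  fun k => iint a (if Nat.eqb (ival k) (ival i) then u else fun _ => 0) (S n).

Lemma component_variation_variation (n : nat) (a b : R) (alpha : idx n -> R) (i : idx n)
  (u : R -> R) : a < b -> (forall i, INR (ival i) < alpha i < INR (ival i) + 1) ->
  ctn u -> (forall s, s <= a -> u s = 0) ->
  variation a b alpha (component_variation a i u).
Proof.
  intros Hab Hal Hu Hu0.
  assert (H : forall k : idx n, let w := if Nat.eqb (ival k) (ival i) then u else fun _ => 0 in
            ctn w /\ forall s, s <= a -> w s = 0).
  { intros k. simpl. destruct Nat.eqb; [easy|]. split; [apply ctn_const|easy]. }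
  split.
  - intros k. destruct (H k). apply iint_regular with (ival k); try easy. apply (proj2_sig k).
  - intros k j Hj. destruct (H k) as [H1 H2]. pose proof (proj2_sig k) as Hk. fold (ival k) in Hk.
    unfold component_variation. rewrite dern_iint by (easy || lra || (simpl in *; lia)).
    apply iint_vanish; [easy|easy|lra].
Qed.

(** An equality of functions, because [caputoL] acts on whole functions and not on values. *)
Lemma perturb_component (n : nat) (a : R) (i : idx n) (u : R -> R) (x : idx n -> R -> R) (e : R) :
  forall k, perturb x (component_variation a i u) e k
    = if Nat.eqb (ival k) (ival i) then fun t => x i t + e * iint a u (S n) t else x k.
Proof.
  intros k. apply functional_extensionality. intros t.
  unfold perturb, component_variation.
  destruct (Nat.eqb_spec (ival k) (ival i)) as [E|].
  - now rewrite (ival_inj n k i E).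
  - rewrite iint_0. ring.
Qed.

Lemma perturb_0 (n : nat) (x eta : idx n -> R -> R) : perturb x eta 0 = x.
Proof.
  apply functional_extensionality. intros k. apply functional_extensionality. intros t.
  unfold perturb. ring.
Qed.

Lemma perturb_component_value (n : nat) (a : R) (i : idx n) (u : R -> R)
  (x : idx n -> R -> R) (e t : R) :
  (fun k => perturb x (component_variation a i u) e k t)
  = upd (fun k => x k t) i (x i t + e * iint a u (S n) t).
Proof.
  apply functional_extensionality. intros k. rewrite perturb_component. unfold upd.
  now destruct Nat.eqb.
Qed.

Lemma caputoV_perturb_component (n : nat) (a b : R) (alpha : idx n -> R) (i : idx n)
  (u : R -> R) (x : idx n -> R -> R) (e t : R) :
  a < b -> a <= t <= b -> INR (ival i) < alpha i < INR (ival i) + 1 ->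
  Ck_on n a b (x i) -> ctn u -> (forall s, s <= a -> u s = 0) ->
  caputoV a b alpha (perturb x (component_variation a i u) e) t
  = upd (caputoV a b alpha x t) i
      (caputoV a b alpha x t i + e * caputoL a b (alpha i) (iint a u (S n)) t).
Proof.
  intros Hab Ht Hal Hx Hu Hu0.
  apply functional_extensionality. intros k. unfold caputoV at 1.
  rewrite perturb_component. unfold upd.
  destruct (Nat.eqb_spec (ival k) (ival i)) as [E|]; [|easy].
  rewrite (ival_inj n k i E). pose proof (proj2_sig i) as Hi. fold (ival i) in Hi.
  apply (caputoL_lin a b (alpha i) e (x i) _ n t Hab Ht).
  - rewrite (mord_between _ _ Hal), S_INR. lra.
  - rewrite (mord_between _ _ Hal). simpl in Hi. lia.
  - easy.
  - now apply (iint_regular a b (alpha i) n (ival i)).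
Qed.

(** * The weak Euler-Lagrange equation and the theorem *)

Lemma weak_Euler_Lagrange (a b : R) (n : nat) (alpha : idx n -> R)
  (za : R) (L : Lag n) (zsol : (idx n -> R -> R) -> R -> R) (x : idx n -> R -> R)
  (i : idx n) (A B C : R -> R) :
  a < b ->
  (forall i, INR (ival i) < alpha i < INR (ival i) + 1) ->
  C1_Lag a b L -> regular a b alpha x ->
  solves_ivp a b alpha L za x (zsol x) ->
  (forall eta, variation a b alpha eta ->
     exists delta, 0 < delta /\ forall e, Rabs e < delta ->
       solves_ivp a b alpha L za (perturb x eta e) (zsol (perturb x eta e))) ->
  (forall eta, variation a b alpha eta -> ex_derive (fun e => zsol (perturb x eta e) b) 0) ->
  (forall eta, variation a b alpha eta ->
     Derive (fun e => zsol (perturb x eta e) b) 0 = 0) ->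
  ctn A -> ctn B -> ctn C ->
  (forall t, a <= t <= b ->
     A t = dLx L i t (fun k => x k t) (caputoV a b alpha x t) (zsol x t)) ->
  (forall t, a <= t <= b ->
     B t = dLv L i t (fun k => x k t) (caputoV a b alpha x t) (zsol x t)) ->
  (forall t, a <= t <= b ->
     C t = dLz L t (fun k => x k t) (caputoV a b alpha x t) (zsol x t)) ->
  let beta := INR (S (ival i)) - alpha i in
  let p := (n - ival i)%nat in
  forall u, ctn u -> (forall s, s <= a -> u s = 0) ->
  RInt (fun t => exp (- RInt C a t) * (A t * iint a u (S (ival i) + p) t
    + B t * (/ Gamma beta * / beta * lker beta a b (iint a u p) t))) a b = 0.
Proof.
  intros Hab Hal HL Hreg [Hza Hz] Hpert Hdiff Hext HA HB HC EA EB EC beta p u Hu Hu0.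
  pose proof (proj2_sig i) as Hi. fold (ival i) in Hi. simpl in Hi.
  assert (Hp : (S (ival i) + p = S n)%nat) by (unfold p; lia).
  rewrite Hp.
  assert (Hb : 0 < beta) by (unfold beta; rewrite S_INR; specialize (Hal i); lra).
  set (h := iint a u (S n)).
  set (D := fun t => / Gamma beta * / beta * lker beta a b (iint a u p) t).
  assert (HD : forall t, a <= t <= b -> caputoL a b (alpha i) h t = D t).
  { intros t Ht. unfold h. rewrite <- Hp. now apply caputoL_iint. }
  set (eta := component_variation a i u).
  assert (Heta : variation a b alpha eta) by now apply component_variation_variation.
  destruct (Hpert eta Heta) as [d0 [Hd0 Hsol]].
  set (X := fun t (k : idx n) => x k t). set (V := caputoV a b alpha x). set (Z := zsol x).
  assert (HX : forall k, cont_on a b (fun t => X t k)).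
  { intros k. apply (proj2 (proj1 (Hreg k)) O). lia. }
  assert (HV : forall k, cont_on a b (fun t => V t k)).
  { intros k. apply (proj2 (proj2 (Hreg k)) O). lia. }
  assert (HZ : cont_on a b Z) by (eapply is_deriv_in_cont; exact Hz).
  assert (E0 : forall (f : idx n -> R), upd f i (f i + 0) = f).
  { intros f. now rewrite Rplus_0_r, upd_id. }
  (* [F] is the Lagrangian recentred at the trajectory, with increments in component [i] and in the
     state only. *)
  apply (linearized_state_equation a b d0
    (fun t p q w => L t (upd (X t) i (X t i + p)) (upd (V t) i (V t i + q)) (Z t + w))
    A B C h D Z (fun e => zsol (perturb x eta e))); auto.
  - unfold h. now apply iint_ctn.
  - unfold D. apply ctn_mult; [apply ctn_const|]. apply lker_ctn; [easy|now apply iint_ctn].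
  - intros eps He.
    destruct (Lagrangian_expansion n a b L i X V Z eps HL HX HV HZ He) as [rho [Hrho H]].
    exists rho. split; [easy|]. intros t q1 q2 w Ht H1 H2 H3.
    rewrite !E0, Rplus_0_r, EA, EB, EC by easy. now apply H.
  - intros t Ht. rewrite !E0, Rplus_0_r. now apply Hz.
  - intros e He. destruct (Hsol e He) as [Hya Hy]. split; [now rewrite Hya|].
    intros t Ht. rewrite <- HD by easy. unfold X, V, h.
    rewrite <- caputoV_perturb_component by (auto; apply Hreg).
    rewrite <- perturb_component_value. fold eta.
    replace (Z t + _) with (zsol (perturb x eta e) t) by ring. now apply Hy.
  - now rewrite perturb_0.
  - rewrite <- (Hext eta Heta) at 2. now apply Derive_correct, Hdiff.
Qed.

Theorem theorem3p4 (a b : R) (n : nat) (alpha : idx n -> R)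
  (za : R) (xa : idx n -> nat -> R) (L : Lag n)
  (zsol : (idx n -> R -> R) -> R -> R) (x : idx n -> R -> R) :
  a < b ->
  (forall i, INR (ival i) < alpha i < INR (ival i) + 1) ->
  C1_Lag a b L ->
  admissible a b alpha xa x ->
  solves_ivp a b alpha L za x (zsol x) ->
  (forall eta, variation a b alpha eta ->
     exists delta, 0 < delta /\ forall e, Rabs e < delta ->
       solves_ivp a b alpha L za (perturb x eta e) (zsol (perturb x eta e))) ->
  (forall eta, variation a b alpha eta -> forall t, a <= t <= b ->
     ex_derive (fun e => zsol (perturb x eta e) t) 0) ->
  (forall i, rl_right_exists_cont a b (alpha i) (lamLv a b alpha L x (zsol x) i)) ->
  (forall eta, variation a b alpha eta ->
     Derive (fun e => zsol (perturb x eta e) b) 0 = 0) ->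
  (forall i t, a <= t <= b ->
     lam a b alpha L x (zsol x) t
       * dLx L i t (fun k => x k t) (caputoV a b alpha x t) (zsol x t)
     + rl_right a b (alpha i) (lamLv a b alpha L x (zsol x) i) t = 0) /\
  (forall i j, (j <= ival i)%nat ->
     rl_right_op a b (alpha i + INR j - (INR (ival i) + 1))
                 (lamLv a b alpha L x (zsol x) i) b = 0).
Proof.
  intros Hab Hal HL [Hreg _] Hsol Hpert Hdiff _ Hext.
  set (X := fun t (k : idx n) => x k t). set (V := caputoV a b alpha x). set (Z := zsol x).
  assert (HX : forall k, cont_on a b (fun t => X t k)).
  { intros k. apply (proj2 (proj1 (Hreg k)) O). lia. }
  assert (HV : forall k, cont_on a b (fun t => V t k)).
  { intros k. apply (proj2 (proj2 (Hreg k)) O). lia. }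
  assert (HZ : cont_on a b Z) by (eapply is_deriv_in_cont; apply Hsol).
  set (ext := fun (H : Lag n) t =>
    let s := clamp a b t in H s (X s) (V s) (Z s)).
  assert (Hext_ctn : forall H, cont_dom a b H -> ctn (ext H)).
  { intros H HH. apply (cont_on_clamp a b (fun s => H s (X s) (V s) (Z s))); [lra|].
    now apply cont_on_along. }
  assert (Hext_eq : forall H t, a <= t <= b -> ext H t = H t (X t) (V t) (Z t)).
  { intros H t Ht. unfold ext. now rewrite clamp_id. }
  pose proof HL as [_ [_ [_ [HLx [HLv HLz]]]]].
  set (C := ext (dLz L)). assert (HC : ctn C) by now apply Hext_ctn.
  set (lm := fun t => exp (- RInt C a t)).
  assert (Hlm : ctn lm) by (unfold lm; auto 6 with ctn).
  assert (Hlam : forall t, a <= t <= b -> lam a b alpha L x (zsol x) t = lm t).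
  { intros t Ht. unfold lam, lm. do 2 f_equal. apply RInt_ext_on; [lra|].
    intros s Hs. symmetry. apply Hext_eq. lra. }
  enough (H : forall i,
    (forall t, a <= t <= b -> lm t * ext (dLx L i) t
       + rl_right a b (alpha i) (lamLv a b alpha L x (zsol x) i) t = 0) /\
    (forall j, (j <= ival i)%nat -> rl_right_op a b (alpha i + INR j - (INR (ival i) + 1))
                 (lamLv a b alpha L x (zsol x) i) b = 0)).
  { split.
    - intros i t Ht. rewrite Hlam by easy. rewrite <- (proj1 (H i) t Ht).
      now rewrite Hext_eq.
    - intros i. apply H. }
  intros i.
  (* In [G] the multiplier is clamped as well: the right kernel integral requires a function
     constant beyond [b], and [lm] continues to vary there. *)
  apply Euler_Lagrange_of_weak_form with (p := (n - ival i)%nat)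
    (G := fun t => lm (clamp a b t) * ext (dLv L i) t); auto.
  - apply ctn_mult; [easy|]. now apply Hext_ctn.
  - apply ctn_mult; [|now apply Hext_ctn].
    apply cont_on_clamp; [lra|]. now apply cont_on_of_ctn with lm.
  - intros s Hs. unfold ext. now rewrite !clamp_ge by lra.
  - intros t Ht. unfold lamLv. rewrite Hlam, clamp_id, Hext_eq by easy. reflexivity.
  - intros u Hu Hu0.
    rewrite <- (weak_Euler_Lagrange a b n alpha za L zsol x i (ext (dLx L i)) (ext (dLv L i)) C)
      with (u := u); auto.
    + apply RInt_ext_on; [lra|]. intros t Ht. rewrite clamp_id by lra. fold (lm t). ring.
    + intros eta Heta. apply Hdiff; [easy|lra].
    + intros t Ht. now apply Hext_eq.
Qed.
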